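(* Let $S = \frac{\varphi}{\sqrt{5}}\left(1 + \sum_{g \geq 3} s_g \varphi^{-g}\right)$. Then $\limsup_{g \to \infty} |n_g - S\varphi^g|^{1/g} \leq \mathsf{r}_{1.54}$.
   Context: A numerical semigroup $\Lambda$ is an additive submonoid of the nonnegative integers $\mathbb{N}_0$ with finite complement $\mathbb{N}_0 \setminus \Lambda$. Its genus is $g(\Lambda) = |\mathbb{N}_0 \setminus \Lambda|$, its multiplicity is $m(\Lambda) = \min(\Lambda \setminus \{0\})$, its conductor is $c(\Lambda) = \min\{c \in \mathbb{N}_0 : c + \mathbb{N}_0 \subseteq \Lambda\}$, and its depth is $q(\Lambda) = \lceil c(\Lambda)/m(\Lambda) \rceil$. Let $n_g$ be the number of numerical semigroups of genus $g$, let $t_g$ be the number of numerical semigroups of genus $g$ with depth $q \leq 3$, and let $s_g = t_g - t_{g-1} - t_{g-2}$ for $g \ge 3$. Let $\varphi = \frac{1+\sqrt 5}{2}$. The constant $\mathsf{r}_{1.54} \approx 1.54930$ is defined so that $1/\mathsf{r}_{1.54}$ is the unique positive zero of the polynomial $x^4(x+1)^2(x^4+2x^3+x^2+1) - 1$. *)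

(* Defs.v *)
From HB Require Import structures.
From mathcomp Require Import all_boot all_order all_algebra.
From mathcomp Require Import finmap.
From mathcomp Require Import all_classical all_reals all_analysis.

Set Implicit Arguments.
Unset Strict Implicit.
Unset Printing Implicit Defensive.

Import Order.TTheory GRing.Theory Num.Theory.
Import numFieldNormedType.Exports.

Local Open Scope classical_set_scope.
Local Open Scope ring_scope.

(* Cardinality of a finite set; the value on infinite sets is irrelevant. *)
Definition card_set (T : choiceType) (A : set T) : nat := #|` fset_set A|.

Definition is_least (A : set nat) (a : nat) : Prop :=
  A a /\ forall b, A b -> (a <= b)%N.

(* The minimum of a nonempty set of naturals (0 on the empty set). *)
Definition nat_min (A : set nat) : nat := xget 0%N (is_least A).

Record numerical_semigroup (L : set nat) : Prop := NumericalSemigroup {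
  semigroup0 : L 0%N;
  semigroupD : forall a b, L a -> L b -> L (a + b)%N;
  semigroup_cofinite : finite_set (~` L)
}.

Definition genus (L : set nat) : nat := card_set (~` L).

Definition multiplicity (L : set nat) : nat := nat_min (L `\ 0%N).

Definition conductor (L : set nat) : nat :=
  nat_min [set c | forall k, L (c + k)%N].

Definition depth (L : set nat) : int :=
  Num.ceil ((conductor L)%:R / (multiplicity L)%:R : rat).

(* The two families counted below are finite for every g: all gaps of a
   numerical semigroup of genus g are smaller than 2g. *)
Definition n_ (g : nat) : nat :=
  card_set [set L | numerical_semigroup L /\ genus L = g].

Definition t_ (g : nat) : nat :=
  card_set [set L | [/\ numerical_semigroup L, genus L = g & depth L <= 3]].

(* Only used for 3 <= g, where the index subtractions are exact. *)
Definition s_ (g : nat) : int :=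
  (t_ g)%:Z - (t_ (g - 1))%:Z - (t_ (g - 2))%:Z.

Definition phi (R : realType) : R := (1 + Num.sqrt 5) / 2.

Definition s_partial_sum (R : realType) (N : nat) : R :=
  \sum_(3 <= g < N) (s_ g)%:~R * phi R ^- g.

Definition S_const (R : realType) : R :=
  phi R / Num.sqrt 5 * (1 + limn (@s_partial_sum R)).

Definition r154_poly (R : realType) : {poly R} :=
  'X^4 * ('X + 1) ^+ 2 * ('X^4 + 2 *: 'X^3 + 'X^2 + 1) - 1.

Definition r154 (R : realType) : R :=
  (xget 0 [set x : R | 0 < x /\ root (r154_poly R) x])^-1.

(* Main.v *)
Require Import Defs.
From mathcomp Require Import all_boot all_order all_algebra.
From mathcomp Require Import finmap.
From mathcomp Require Import all_classical all_reals all_analysis.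
From mathcomp Require Import ring lra zify.
From mathcomp Require Import finset fintype bigop.
Set Implicit Arguments.
Unset Strict Implicit.
Unset Printing Implicit Defensive.
Import Order.TTheory GRing.Theory Num.Theory.
Import numFieldNormedType.Exports.
Local Open Scope ring_scope.

(** A numerical semigroup of multiplicity [m] is determined by its Kunz word: the
    letters [w_1], ..., [w_(m-1)] such that [i + m w_i] is the least element
    congruent to [i]. The letters are positive, their sum is the genus, their
    maximum is the depth, and the words that occur are those with
    [w_(i+j mod m) <= w_i + w_j + (m <= i + j)], where [w_0 = 0].

    For letters at most 3 the only condition is that no 3 stands at a position
    [i + j] with letters 1 at [i] and at [j]. Appending 1 or 2 is always possible.
    Hence [s_ g] is the number of such words of sum [g] that end in 3, and [t_] is
    a Fibonacci sequence with forcing term [s_]. If both [s_ g] and [n_ g - t_ g]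
    are [O(rate ^+ g)] for some [rate] less than [phi], then solving the
    recurrence ([growing_part_psum], [decaying_part_le]) gives convergence of the
    series and [n_ g = S phi^g + O(rate ^+ g)] ([error_le]). The value
    [rate = 1.549] is slightly less than [r154] ([r154_gt]), which is enough.

    To bound the number of words, give the letter [l] the weight [x^l] for
    [x = 11 / 17]. It suffices that the words of length [m] that are to be counted
    have total weight [exp(o(m))], since [1 / x] is less than [rate]. A letter [p]
    at position [t] forces the letters at [v] and [t - v mod m] to have sum at
    least [p], or [p - 1] if the positions wrap around. When [p] stands at a set
    [T] of [k^2] positions, a container argument applies: a fingerprint of size
    [O(m / k)] determines for every position a list containing its letter
    ([fingerprint_allowed]), and for some [t] in [T] the lists at [v] and [t - v]
    are compatible for all but [m / k] of the [v] ([few_clashes]). The number of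
    fingerprints is [exp(o(m))] for large [k], the weight of a product of lists is
    a product, and pairing [v] with [t - v] leaves a numerical inequality between
    two letters.

    If some [p >= 4] is frequent, take the largest such [p] and for [T] its
    topmost occurrences; above [t] nearly all letters are then less than [p], and
    the inequality is [sum_pair_le1]. Otherwise letters above 3 are rare. In a word
    of depth at least 4, as well as in a word that the letter 3 may follow, there
    is nevertheless one reflection whose sums are all at least 3. Together with
    the container for the letter 3, it leads to
    [(x + x^2 + x^3) (x^2 + x^3) (x + x^2) < 1] ([low_prod_le]). Finally, a letter
    at least 15 makes the mean letter so large that the words concerned are few for
    trivial reasons ([kunz_long], [long_growth]). *)

Local Notation all_pos := (all (fun a => 0 < a)%N).

(** * Finite sums and small subsets *)

Lemma bernoulli_ineq (R : realType) (h : R) n : 0 <= h -> 1 + n%:R * h <= (1 + h) ^+ n.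
Proof.
move=> h0; elim: n => [|n IH]; first by rewrite mul0r addr0.
have h1 : 0 <= 1 + h by apply: addr_ge0.
rewrite exprS; apply: le_trans (ler_wpM2l h1 IH).
rewrite -natr1; have := ler0n R n; move: (n%:R) => x x0; nra.
Qed.

Lemma sum_sub_le (R : realType) (X : finType) (W W' : pred X) (w : X -> R) :
  (forall f, 0 <= w f) -> (forall f, W f -> W' f) ->
  \sum_(f | W f) w f <= \sum_(f | W' f) w f.
Proof.
move=> w0 WW'; rewrite [leRHS](bigID W) /= -[leLHS]addr0; apply: lerD; last exact: sumr_ge0.
rewrite le_eqVlt; apply/orP; left; apply/eqP; apply: eq_bigl => f.
by rewrite andbC; case Wf : (W f) => //=; rewrite WW'.
Qed.

Lemma sum_or_le (R : realType) (X : finType) (W W1 W2 : pred X) (w : X -> R) :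
  (forall f, 0 <= w f) -> (forall f, W f -> W1 f || W2 f) ->
  \sum_(f | W f) w f <= \sum_(f | W1 f) w f + \sum_(f | W2 f) w f.
Proof.
move=> w0 WW; rewrite (bigID W1) /=; apply: lerD; apply: sum_sub_le => // f /andP[Wf] //.
by have := WW f Wf; case: (W1 f).
Qed.

Lemma union_bound (R : realType) (X D : finType) (W : pred X) (P : pred D)
    (W' : D -> pred X) (w : X -> R) (M : R) : (forall f, 0 <= w f) ->
  (forall f, W f -> exists2 d, P d & W' d f) ->
  (forall d, P d -> \sum_(f | W' d f) w f <= M) ->
  \sum_(f | W f) w f <= #|P|%:R * M.
Proof.
move=> w0 WP WM.
apply: (@le_trans _ _ (\sum_(d | P d) \sum_(f | W' d f) w f)); last first.
  by apply: le_trans (ler_sum _ WM) _; rewrite sumr_const mulr_natl.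
rewrite (exchange_big_dep xpredT) //= [leRHS](bigID W) /= -[leLHS]addr0; apply: lerD; last first.
  by apply: sumr_ge0 => f _; apply: sumr_ge0.
apply: ler_sum => f Wf; have [d Pd W'd] := WP f Wf.
by rewrite (bigD1 d) ?Pd //= lerDl sumr_ge0.
Qed.

(** If [G] is given the weight [b ^- #|G|], all the subsets together weigh
    [(1 + b^-1) ^+ #|Y|]. With [b] large, this shows that the sets of size
    [o(#|Y|)] number only [exp(o(#|Y|))]; no estimate of binomial coefficients
    is needed. *)
Lemma card_small_sets (R : realType) (Y : finType) (r : nat) (b : R) : 1 <= b ->
  #|[set G : {set Y} | #|G| <= r]%N|%:R <= b ^+ r * (1 + b^-1) ^+ #|Y|.
Proof.
move=> b1; have b0 : 0 < b by apply: lt_le_trans b1.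
have -> : (1 + b^-1) ^+ #|Y| = \sum_(G : {set Y}) b^-1 ^+ #|G|.
  rewrite -prodr_const (_ : \prod_(i in Y) _ = \prod_(i : Y) (b^-1 + 1)); last first.
    by apply: eq_bigr => i _; rewrite addrC.
  rewrite bigA_distr; apply: eq_bigr => G _.
  by rewrite -big_mkcond /= prodr_const.
rewrite mulr_sumr -sum1dep_card natr_sum [leRHS](bigID (fun G : {set Y} => #|G| <= r)%N) /=.
rewrite -[leLHS]addr0; apply: lerD.
  apply: ler_sum => G Gr; rewrite -(subnK Gr) exprD -mulrA -exprMn divff ?gt_eqF //.
  by rewrite expr1n mulr1 exprn_ege1.
by apply: sumr_ge0 => G _; rewrite mulr_ge0 ?exprn_ge0 ?invr_ge0 ?ltW.
Qed.

(** * Containers for cyclic words *)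

(** Take for [F] a largest subset of [A] whose elements, added one by one, each
    contribute at least [k] new tokens: an element of [A] with [k] tokens still
    missing could be added to it. *)
Lemma greedy_fingerprint (Y U : finType) (N : Y -> {set U}) (A : {set Y}) (k : nat) :
  (0 < k)%N ->
  exists F : {set Y}, [/\ F \subset A, (#|F| * k <= #|U|)%N &
    forall v, v \in A -> (#|N v :\: \bigcup_(w in F) N w| < k)%N].
Proof.
move=> k0.
pose P (F : {set Y}) := (F \subset A) && (#|F| * k <= #|\bigcup_(w in F) N w|)%N.
have P0 : P set0 by rewrite /P sub0set cards0.
case: (@arg_maxnP _ set0 P (fun F => #|F|) P0) => F /andP[FA Fk] Fmax.
exists F; split=> // [|v vA]; first exact: leq_trans Fk (max_card _).
rewrite ltnNge; apply/negP => kN.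
have vF : v \notin F.
  apply/negP => vF; move: kN; rewrite leqNgt => /negP; apply.
  rewrite (_ : _ :\: _ = set0) ?cards0 //; apply/eqP.
  by rewrite setD_eq0 (bigcup_sup v).
have /Fmax : P (v |: F).
  rewrite /P subUset sub1set vA FA cardsU1 vF /= mulnDl mul1n.
  rewrite bigcup_setU big_set1 -(cardsID (\bigcup_(w in F) N w)) addnC leq_add //.
    by apply: (leq_trans Fk); rewrite setIUl setIid subset_leq_card ?subsetUr.
  by rewrite setDUl setDv setU0.
by rewrite /geq /= cardsU1 vF add1n ltnn.
Qed.

Lemma val_refl n (t v : 'I_n.+1) :
  ((t - v)%R : nat) = (if t < v then t + n.+1 - v else t - v)%N.
Proof.
have -> : ((t - v)%R : nat) = ((t + (n.+1 - v)) %% n.+1)%N by rewrite /= modnDmr.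
have := ltn_ord t; have := ltn_ord v; case: (ltnP t v) => [tv|vt] vm tm.
  by rewrite modn_small; lia.
rewrite (_ : (t + _)%N = (t - v + n.+1)%N); last by lia.
by rewrite modnDr modn_small; lia.
Qed.

Section Container.
Variable m : nat.
Local Notation V := 'I_m.+1.
Local Notation letter := 'I_15.
Implicit Types (T : {set V}) (F : {set V * letter}) (f : V -> letter).

(** In 'I_m.+1, read as Z/(m + 1), the reflection [v |-> t - v] pairs the
    positions with sum [t]. The bit [t < v] tells that the sum of the two
    positions wraps around; the Kunz inequality is weaker by one in that case. *)
Definition refl_ge (p : nat) f (t : V) :=
  forall v : V, (p <= f v + f (t - v)%R + (t < v)%N)%N.

(** A letter [l] at [v] constrains, for each [t] in [T], the letter at [t - v];
    the token records that position, the wrap-around bit of the pair, and [l]. *)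
Definition token T (y : V * letter) : {set V * bool * letter} :=
  [set ((t - y.1)%R, (t < y.1)%N, y.2) | t in T].

Definition hit T F := (\bigcup_(y in F) token T y)%SET.

(** The letters that a fingerprint [F] leaves possible at [v]. By the choice of
    [F], a letter actually present has fewer than [k] tokens outside [hit T F];
    and it must obey the inequality with every letter recorded at [v]. *)
Definition allowed T F (k p : nat) (v : V) (l : letter) : bool :=
  (#|token T (v, l) :\: hit T F| < k)%N &&
  [forall l' : letter, forall b : bool,
     ((v, b, l') \in hit T F) ==> (p <= l + l' + b)%N].

Definition clash T F k p (t : V) : {set V} :=
  [set v : V | [exists l : letter, exists l' : letter,
    [&& allowed T F k p v l, allowed T F k p (t - v)%R l' &
        (l + l' + (t < v) < p)%N]]].

Lemma ltn_refl (t v : V) : (t < (t - v)%R)%N = (t < v)%N.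
Proof.
by rewrite val_refl; have := ltn_ord v; case: (ltnP t v) => tv vm; lia.
Qed.

(** The container step: the word enters only through [F], which is small, and
    the lists computed from [T] and [F] contain all its letters. *)
Lemma fingerprint_allowed f T k p : (0 < k)%N -> {in T, forall t, refl_ge p f t} ->
  exists F, (#|F| * k <= 30 * m.+1)%N /\ forall v, allowed T F k p v (f v).
Proof.
move=> k0 Tf.
have [F [FA Fk NF]] := @greedy_fingerprint _ _ (token T) [set (v, f v) | v : V]%SET k k0.
exists F; split.
  by apply: leq_trans Fk _; rewrite !card_prod !card_ord card_bool; lia.
move=> v; rewrite /allowed NF ?imset_f //=.
apply/forallP => l'; apply/forallP => b; apply/implyP => /bigcupP[y yF].
case/imsetP => t tT [vE bE lE].
have /imsetP[w _ yE] := subsetP FA _ yF.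
by have := Tf t tT w; rewrite vE bE lE yE /= [X in (_ <= X + _)%N -> _]addnC.
Qed.

(** Let [l] be the least allowed letter at [v]. Fewer than [k] of its tokens are
    missing from [hit T F]. For every other [t], the list at [t - v] obeys the
    inequality with [l], hence with the whole list at [v]. So each [v] clashes
    for fewer than [k] of the [k * k] elements of [T], and some [t] sees at most
    the average number of clashes. *)
Lemma few_clashes T F k p : (#|T| = k * k)%N -> (0 < k)%N ->
  exists2 t, t \in T & (#|clash T F k p t| * k <= m.+1)%N.
Proof.
move=> Tk k0.
have T0 : (0 < #|T|)%N by rewrite Tk muln_gt0 k0.
suff H : (\sum_(t in T) #|clash T F k p t| <= k * m.+1)%N.
  apply/exists_inP; rewrite -[X in is_true X]negbK negb_exists_in.
  apply/negP => /forall_inP big.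
  have : (\sum_(t in T) #|clash T F k p t| * k >= \sum_(t in T) m.+2)%N.
    by apply: leq_sum => t tT; have := big t tT; rewrite -ltnNge.
  rewrite -big_distrl sum_nat_const Tk /=; move=> h.
  by have := leq_trans h (leq_mul H (leqnn k)); nia.
apply: (@leq_trans (\sum_(v : V) #|[set t in T | v \in clash T F k p t]|)%N).
  apply: eq_leq.
  under eq_bigr do rewrite -sum1_card.
  rewrite (exchange_big_dep xpredT) //=; apply: eq_bigr => v _.
  by rewrite -sum1_card; apply: eq_bigl => t; rewrite inE.
rewrite -[X in (_ <= k * X)%N](card_ord m.+1) mulnC -sum_nat_const.
apply: leq_sum => v _.
have [/existsP[l0 al0]|/existsPn noal] := boolP [exists l, allowed T F k p v l]; last first.
  rewrite (_ : finset _ = set0) ?cards0 //; apply/setP => t; rewrite !inE.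
  apply/negP => /andP[_ /existsP[l /existsP[l' /and3P[al _ _]]]].
  by move: (noal l); rewrite al.
case: (@arg_minnP _ l0 (allowed T F k p v) (fun l => l : nat) al0) => l al lmin.
have /andP[/ltnW tokk _] := al.
apply: leq_trans tokk.
have inj : injective (fun t : V => ((t - v)%R, (t < v)%N, l)).
  by move=> t t' /(congr1 (fun z => z.1.1))/addIr.
rewrite -(card_imset _ inj); apply/subset_leq_card/fintype.subsetP => z /imsetP[t].
rewrite inE => /andP[tT]; rewrite inE => /existsP[l1 /existsP[l2 /and3P[al1 al2 sm]]] zE.
rewrite zE {z zE}.
rewrite inE andbC; apply/andP; split; first by apply/imsetP; exists t.
apply/negP => th; have /andP[_ /forallP/(_ l)/forallP/(_ (t < v)%N)] := al2.
rewrite th /= => pl; have := lmin _ al1; lia.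
Qed.
End Container.

(** * Weights of letters and of words *)

(** The square of the product is the product of the [c v * c (rho v)], which
    avoids choosing one element in each orbit of [rho]. *)
Lemma prod_involution (R : realType) (V : finType) (c : V -> R) (rho : V -> V)
    (X : {set V}) (C : R) : involutive rho -> 1 <= C ->
  (forall v, 0 <= c v <= C) -> (forall v, v \notin X -> c v * c (rho v) <= 1) ->
  \prod_v c v <= C ^+ #|X|.
Proof.
move=> rhoK C1 cC cX.
have C0 : 0 <= C by apply: le_trans C1.
have c0 v : 0 <= c v by case/andP: (cC v).
rewrite -(@ler_pXn2r _ 2) // ?nnegrE ?prodr_ge0 ?exprn_ge0 //.
rewrite expr2 {2}(reindex_inj (inv_inj rhoK)) /= -big_split /=.
rewrite -exprM mulnC exprM -prodr_const [leRHS]big_mkcond /=.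
apply: ler_prod => v _; rewrite mulr_ge0 //=.
case: ifPn => [_|/cX //]; rewrite expr2.
by apply: ler_pM => //; case/andP: (cC v); case/andP: (cC (rho v)).
Qed.

Lemma sum_words_le (R : realType) (V A : finType) (w : A -> R) (L : V -> pred A)
    (W : pred {ffun V -> A}) : (forall l, 0 <= w l) ->
  (forall f, W f -> forall v, L v (f v)) ->
  \sum_(f | W f) \prod_v w (f v) <= \prod_v \sum_(l | L v l) w l.
Proof.
move=> w0 WL; rewrite bigA_distr_big_dep; apply: sum_sub_le => [f|f Wf].
  exact: prodr_ge0.
by apply/familyP => v; apply: WL.
Qed.

(** To use a condition on the pair of letters at [v] and [sigma v], the letter of
    the follower is moved to its leader: the condition then bears on a single
    coordinate, and the sum over words factors. *)
Lemma sum_words_pairs (R : realType) (V A : finType) (l0 : A) (w : A -> R) (sigma : V -> V)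
    (single lead : pred V) (W : pred {ffun V -> A}) (Q : V -> pred (A * A)) :
  (forall l, 0 <= w l) -> involutive sigma ->
  (forall v, single (sigma v) = single v) ->
  (forall v, ~~ single v -> lead (sigma v) = ~~ lead v) ->
  (forall f, W f -> forall v,
     Q v (if single v then (f v, l0) else if lead v then (f v, f (sigma v)) else (l0, l0))) ->
  \sum_(f | W f) \prod_v w (f v) <=
  \prod_v \sum_(q | Q v q)
    (if single v then w q.1 else if lead v then w q.1 * w q.2 else 1).
Proof.
move=> w0 sK sS sL WQ.
pose code (f : {ffun V -> A}) : {ffun V -> A * A} := [ffun v =>
  if single v then (f v, l0) else if lead v then (f v, f (sigma v)) else (l0, l0)].
pose w2 v (q : A * A) := if single v then w q.1 else if lead v then w q.1 * w q.2 else 1.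
have w20 v q : 0 <= w2 v q by rewrite /w2; case: ifP => // _; case: ifP => // _; apply: mulr_ge0.
have code_inj : injective code.
  move=> f f' /ffunP e; apply/ffunP => v; have := e v; have := e (sigma v).
  rewrite !ffunE sS sK; case: ifPn => [_ _ [] //|/sL ->].
  by case: (lead v) => /= [_ [] //|[] ].
have prodE (f : {ffun V -> A}) : \prod_v w (f v) = \prod_v w2 v (code f v).
  rewrite (bigID single) /= [X in _ * X = _](bigID lead) /= [RHS](bigID single) /=.
  rewrite [X in _ = _ * X](bigID lead) /=; congr (_ * _).
    by apply: eq_bigr => v sv; rewrite /w2 ffunE sv.
  rewrite [X in _ = _ * X]big1 ?mulr1; last first.
    by move=> v /andP[/negPf sv /negPf lv]; rewrite /w2 sv lv.
  rewrite [X in _ * X](reindex_inj (inv_inj sK)) /=.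
  under [X in _ * X]eq_bigl => v.
    rewrite sS (_ : _ && _ = ~~ single v && lead v); last first.
      by case sv : (single v) => //=; rewrite sL ?sv // negbK.
    over.
  rewrite -big_split /=; apply: eq_bigr => v /andP[/negPf sv lv].
  by rewrite /w2 ffunE sv lv.
rewrite (_ : \sum_(f | W f) _ = \sum_(h in [set code f | f in W]) \prod_v w2 v (h v)); last first.
  rewrite big_imset /=; last by move=> f f' _ _; apply: code_inj.
  by apply: eq_bigr => f _; apply: prodE.
rewrite bigA_distr_big_dep; apply: sum_sub_le => [h|_ /imsetP[f Wf ->]].
  by apply: prodr_ge0 => v _; apply: w20.
by apply/familyP => v; rewrite ffunE; apply: WQ.
Qed.

Section Weights.
Variable R : realType.
(** A letter [l] weighs [unit_wt ^+ l]. Writing [x] for this number, two facts fix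
    the choice: [1 / x] is less than the claimed growth rate, about 1.5493, and
    [(x + x^2 + x^3) (x^2 + x^3) (x + x^2) < 1]. *)
Definition unit_wt : R := 11%:R / 17%:R.
Lemma unit_wt_gt0 : 0 < unit_wt. Proof. by rewrite /unit_wt; lra. Qed.
Lemma unit_wtX_ge0 n : 0 <= unit_wt ^+ n. Proof. by rewrite exprn_ge0 // ltW // unit_wt_gt0. Qed.
Lemma unit_wt_le1 : unit_wt <= 1. Proof. by rewrite /unit_wt; lra. Qed.

(** The factor [17 / 6] is [1 / (1 - unit_wt)]. *)
Lemma sum_interval_le (X : pred 'I_15) (a b : nat) : (a <= b.+1)%N -> (b < 15)%N ->
  (forall l, X l -> a <= l <= b)%N ->
  \sum_(l | X l) unit_wt ^+ l <= (unit_wt ^+ a - unit_wt ^+ b.+1) * (17%:R / 6%:R).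
Proof.
move=> ab b15 Xab.
have -> : (unit_wt ^+ a - unit_wt ^+ b.+1) * (17%:R / 6%:R) = \sum_(a <= l < b.+1) unit_wt ^+ l.
  have d0 : (1 - unit_wt) != 0 by rewrite /unit_wt; apply/eqP; lra.
  apply: (mulIf d0); rewrite mulr_suml.
  rewrite (eq_bigr (fun l => - (unit_wt ^+ l.+1 - unit_wt ^+ l))); last first.
    by move=> l _; rewrite exprS; ring.
  rewrite sumrN telescope_sumr // opprB -mulrA (_ : _ * (1 - unit_wt) = 1) ?mulr1 //.
  by rewrite /unit_wt; lra.
rewrite big_geq_mkord (big_ord_widen_cond 15 (fun l => a <= l)%N (fun l => unit_wt ^+ l)) //.
apply: sum_sub_le => l; first exact: unit_wtX_ge0.
by move=> /Xab /andP[-> lb]; rewrite ltnS lb.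
Qed.

Lemma sum_letters_le2 (X : pred 'I_15) : (forall l, X l -> 0 < l)%N ->
  \sum_(l | X l) unit_wt ^+ l <= 2.
Proof.
move=> X0; have h l : X l -> (1 <= l <= 14)%N by move=> /X0 ->; rewrite -ltnS ltn_ord.
apply: le_trans (@sum_interval_le X 1 14 isT isT h) _; rewrite /unit_wt; lra.
Qed.

(** If [a] and [a'] are the least elements of [X] and [Y], then [a + a' >= b], and
    geometric series bound the product by [unit_wt ^+ b / (1 - unit_wt) ^+ 2],
    which is at most 1 from [b = 5] on. For [b = 3] and [b = 4] the upper bound
    [b] on the letters is needed as well, and there are few cases. *)
Lemma sum_pair_le1 (b : nat) (X Y : pred 'I_15) : (3 <= b <= 14)%N ->
  (forall l, X l -> 0 < l <= b)%N -> (forall l, Y l -> 0 < l <= b)%N ->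
  (forall l l', X l -> Y l' -> b <= l + l')%N ->
  (\sum_(l | X l) unit_wt ^+ l) * (\sum_(l | Y l) unit_wt ^+ l) <= 1.
Proof.
move=> b314 Xb Yb XY.
have [l0 Xl0|X0] := pickP X; last by rewrite (big_pred0 _ _ _ _ X0) mul0r.
have [m0 Ym0|Y0] := pickP Y; last by rewrite (big_pred0 _ _ _ _ Y0) mulr0.
case: (@arg_minnP _ l0 X (fun l => l : nat) Xl0) => l Xl lmin.
case: (@arg_minnP _ m0 Y (fun l => l : nat) Ym0) => l' Yl lmin'.
have lb := Xb _ Xl; have lb' := Yb _ Yl; have ll := XY _ _ Xl Yl.
have hX : \sum_(l | X l) unit_wt ^+ l <= (unit_wt ^+ l - unit_wt ^+ b.+1) * (17%:R / 6%:R).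
  apply: sum_interval_le; [lia|lia|] => i Xi; rewrite lmin //=.
  by case/andP: (Xb _ Xi).
have hY : \sum_(l | Y l) unit_wt ^+ l <= (unit_wt ^+ l' - unit_wt ^+ b.+1) * (17%:R / 6%:R).
  apply: sum_interval_le; [lia|lia|] => i Xi; rewrite lmin' //=.
  by case/andP: (Yb _ Xi).
have sX0 : 0 <= \sum_(l | X l) unit_wt ^+ l by apply: sumr_ge0 => *; apply: unit_wtX_ge0.
have sY0 : 0 <= \sum_(l | Y l) unit_wt ^+ l by apply: sumr_ge0 => *; apply: unit_wtX_ge0.
apply: le_trans (ler_pM sX0 sY0 hX hY) _.
move: lb lb' ll; clear lmin lmin' Xl Yl hX hY.
move: (nat_of_ord l) (nat_of_ord l') => {}l {}l' lb lb' ll.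
have [b5|b5] := leqP 5 b.
  have le17 (n : nat) :
      (unit_wt ^+ n - unit_wt ^+ b.+1) * (17%:R / 6%:R) <= unit_wt ^+ n * (17%:R / 6%:R).
    by apply: ler_wpM2r; [lra|rewrite gerBl unit_wtX_ge0].
  have ge0 (n : nat) : (n <= b)%N -> 0 <= (unit_wt ^+ n - unit_wt ^+ b.+1) * (17%:R / 6%:R).
    move=> nb; apply: mulr_ge0; last by lra.
    by rewrite subr_ge0 ler_wiXn2l ?unit_wt_le1 ?ltW ?unit_wt_gt0 // leqW.
  have [/andP[_ lb1] /andP[_ lb2]] := (lb, lb').
  apply: le_trans (ler_pM (ge0 _ lb1) (ge0 _ lb2) (le17 _) (le17 _)) _.
  rewrite mulrACA -exprD.
  have : unit_wt ^+ (l + l') <= unit_wt ^+ 5.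
    by rewrite ler_wiXn2l ?unit_wt_le1 ?ltW ?unit_wt_gt0 // (leq_trans b5).
  move=> h; have : unit_wt ^+ 5 * (17%:R / 6%:R * (17%:R / 6%:R)) <= 1 by rewrite /unit_wt; lra.
  by apply: le_trans; apply: ler_wpM2r => //; lra.
move: lb lb' ll; have [->|->] : b = 3%N \/ b = 4%N by lia.
- case: l => [|[|[|[|l]]]] // _; case: l' => [|[|[|[|l']]]] // _ // _; rewrite /unit_wt; lra.
- case: l => [|[|[|[|[|l]]]]] // _; case: l' => [|[|[|[|[|l']]]]] // _ // _; rewrite /unit_wt; lra.
Qed.

(** The letter 1 is set apart because it is the only one whose partner in a pair
    of sum at least 3 is restricted. *)
Lemma sum_interval_split (P : pred 'I_15) (b : nat) (g h : R) : (1 <= b < 15)%N ->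
  (forall l, P l -> 0 < l <= b)%N -> 0 <= g -> 0 <= h ->
  \sum_(l | P l) unit_wt ^+ l * (if l == 1%N :> nat then g else h) <=
    (if P (inord 1) then unit_wt * g else 0) +
      (unit_wt ^+ 2 - unit_wt ^+ b.+1) * (17%:R / 6%:R) * h.
Proof.
move=> b15 Pb g0 h0; rewrite (bigID (pred1 (inord 1 : 'I_15))) /=.
have i1 (l : 'I_15) : (l == inord 1) = (l == 1%N :> nat) by rewrite -val_eqE /= inordK.
apply: lerD.
  case: ifPn => P1.
    rewrite (big_pred1 (inord 1)) ?inordK ?eqxx ?expr1 //.
    by move=> l; rewrite /= andbC; case: eqVneq => //= ->.
  rewrite big_pred0 // => l; rewrite andbC; case: eqVneq => //= ->; exact/negbTE.
rewrite (eq_bigr (fun l : 'I_15 => unit_wt ^+ l * h)); last first.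
  by move=> l /andP[_]; rewrite i1 => /negPf ->.
rewrite -mulr_suml; apply: ler_wpM2r => //; apply: sum_interval_le; [lia|lia|].
by move=> l /andP[/Pb]; rewrite i1; lia.
Qed.

End Weights.

(** * Words compatible with a fingerprint *)

Section Products.
Variable R : realType.
Variable m : nat.
Local Notation V := 'I_m.+1.
Local Notation letter := 'I_15.
Local Notation wx := (unit_wt R).

Lemma refl_involutive (t : V) : involutive (fun v : V => (t - v)%R).
Proof. by move=> v; rewrite subKr. Qed.

(** The positions in [E] are exceptional: no upper bound is imposed on their
    letters. Elsewhere the letters are at most [p], and less than [p] above [t]. *)
Definition high_letters (T : {set V}) F (k p : nat) (t : V) (E : {set V}) (v : V) (l : letter) :=
  [&& (0 < l)%N, allowed T F k p v l & (v \in E) || (l + (t < v) <= p)%N].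

(** At a position without clash, whose reflection is not exceptional either, the
    lists at [v] and [t - v] satisfy the hypotheses of [sum_pair_le1] for
    [b = p - (t < v)]. *)
Lemma high_prod_le (T : {set V}) F (k p : nat) (t : V) E : (4 <= p <= 14)%N ->
  \prod_v \sum_(l | high_letters T F k p t E v l) wx ^+ l
    <= 2 ^+ (#|clash T F k p t| + 2 * #|E|).
Proof.
move=> p414.
pose X := clash T F k p t :|: (E :|: [set (t - v)%R | v in E])%SET.
have cardX : (#|X| <= #|clash T F k p t| + 2 * #|E|)%N.
  apply: leq_trans (leq_card_setU _ _) _; rewrite leq_add2l.
  by apply: leq_trans (leq_card_setU _ _) _; rewrite mul2n -addnn leq_add2l leq_imset_card.
apply: le_trans (prod_involution (X := X) (C := 2) (@refl_involutive t) _ _ _) _; first by lra.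
- move=> v; apply/andP; split; first by apply: sumr_ge0 => *; apply: unit_wtX_ge0.
  by apply: sum_letters_le2 => l /andP[].
- move=> v; rewrite !inE !negb_or => /and3P[vX vE vE'].
  have tvE : (t - v)%R \notin E.
    by apply: contra vE' => tvE; apply/imsetP; exists (t - v)%R; rewrite ?subKr.
  apply: (@sum_pair_le1 R (p - (t < v))%N).
  + by case: (t < v)%N; lia.
  + by move=> l /and3P[-> _]; rewrite (negPf vE) /=; case: (t < v)%N; lia.
  + move=> l /and3P[-> _]; rewrite (negPf tvE) /= ltn_refl; case: (t < v)%N; lia.
  + move=> l l' /and3P[_ al _] /and3P[_ al' _]; rewrite leqNgt; apply: contra vX => sm.
    apply/existsP; exists l; apply/existsP; exists l'; rewrite al al' /=.
    by move: sm; case: (t < v)%N; lia.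
- by apply: ler_weXn2l => //; lra.
Qed.

(** Here the letters are at most 3 on the low positions and at most 2 on the
    others, up to exceptions in [E], and two reflections are at work. The
    reflection [sigma] pairs letters of sum at least 3 everywhere; [rho] does so
    for the allowed letters of the low positions, outside [X]. The orbits of
    [sigma] are summed exactly, except that two low positions are treated as
    independent; the resulting weights are then paired by [rho]. *)
Section Low.
Variables (S : V -> pred letter) (low : pred V) (rho : V -> V) (E X : {set V}) (c : V).
Hypothesis rhoK : involutive rho.
Hypothesis low_rho : forall v, low (rho v) = low v.
Hypothesis XP : forall v, low v -> v \notin X ->
  forall l l', S v l -> S (rho v) l' -> (3 <= l + l')%N.

Local Notation sigma v := (c - v : V)%R.
Definition low_letters (v : V) (l : letter) :=
  [&& (0 < l)%N, S v l & (v \in E) || (l <= if low v then 3 else 2)%N].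
Definition single (v : V) := low v && low (sigma v) || (sigma v == v).
(** In an orbit with just one low position, this position leads, so that all the
    weight of the orbit is available when the low positions are paired by
    [rho]. *)
Definition lead (v : V) := if low v (+) low (sigma v) then low v else (v < sigma v)%N.

Definition low_pairs (v : V) (q : letter * letter) : bool :=
  if single v then low_letters v q.1 && ((sigma v == v) ==> (3 <= q.1 + q.1)%N) && (q.2 == ord0)
  else if lead v then low_letters v q.1 && (low_letters (sigma v) q.2 && (3 <= q.1 + q.2)%N)
  else q == (ord0, ord0).

Definition low_weight (v : V) : R := \sum_(q | low_pairs v q)
  (if single v then wx ^+ q.1 else if lead v then wx ^+ q.1 * wx ^+ q.2 else 1).

Lemma low_weight_single v : single v -> low_weight v =
  \sum_(l | low_letters v l && ((sigma v == v) ==> (3 <= l + l)%N)) wx ^+ l.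
Proof.
move=> sv; rewrite /low_weight /low_pairs sv.
rewrite -(@pair_big_dep _ _ _ _ _
  (fun l => low_letters v l && ((sigma v == v) ==> (3 <= l + l)%N))
  (fun _ l' => l' == ord0) (fun l _ => wx ^+ l)) /=.
by apply: eq_bigr => l _; rewrite big_pred1_eq.
Qed.

Lemma low_weight_lead v : ~~ single v -> lead v -> low_weight v =
  \sum_(l | low_letters v l) wx ^+ l *
     \sum_(l' | low_letters (sigma v) l' && (3 <= l + l')%N) wx ^+ l'.
Proof.
move=> /negPf sv lv; rewrite /low_weight /low_pairs sv lv.
rewrite -(@pair_big_dep _ _ _ _ _ (low_letters v)
  (fun l l' => low_letters (sigma v) l' && (3 <= l + l')%N)
  (fun l l' => wx ^+ l * wx ^+ l')) /=.
by apply: eq_bigr => l _; rewrite mulr_sumr.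
Qed.

Lemma low_weight_follow v : ~~ single v -> ~~ lead v -> low_weight v = 1.
Proof.
by move=> /negPf sv /negPf lv; rewrite /low_weight /low_pairs sv lv big_pred1_eq.
Qed.

Lemma low_weight_bounds v : 0 <= low_weight v <= 4.
Proof.
apply/andP; split.
  apply: sumr_ge0 => q _; case: ifP => _; first exact: unit_wtX_ge0.
  by case: ifP => // _; rewrite mulr_ge0 ?unit_wtX_ge0.
have [sv|sv] := boolP (single v).
  rewrite low_weight_single //; apply: le_trans (_ : 2 <= 4); last by lra.
  by apply: sum_letters_le2 => l /andP[/andP[]].
have [lv|lv] := boolP (lead v); last by rewrite low_weight_follow //; lra.
rewrite low_weight_lead //.
apply: (@le_trans _ _ (\sum_(l | low_letters v l) wx ^+ l * 2)).
  apply: ler_sum => l _; apply: ler_wpM2l; first exact: unit_wtX_ge0.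
  by apply: sum_letters_le2 => l' /andP[/andP[]].
rewrite -mulr_suml (_ : 4 = 2 * 2 :> R); last by lra.
by apply: ler_wpM2r; [lra|apply: sum_letters_le2 => l /andP[]].
Qed.

Let Z : R := 1337%:R / 1000%:R.
Let Q : R := 735%:R / 1000%:R.

Lemma low_weight_lead_le v : ~~ single v -> lead v -> sigma v \notin E -> ~~ low (sigma v) ->
  low_weight v <= \sum_(l | low_letters v l) wx ^+ l *
    (if l == 1%N :> nat then wx ^+ 2 else wx + wx ^+ 2).
Proof.
move=> sv lv svE nls; rewrite low_weight_lead //.
apply: ler_sum => l _; apply: ler_wpM2l; first exact: unit_wtX_ge0.
case: eqP => [l1|_].
  apply: le_trans (@sum_interval_le R _ 2 2 _ _ _) _ => //; last by rewrite /unit_wt; lra.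
  move=> l' /andP[/and3P[_ _]]; rewrite (negPf svE) (negPf nls) l1 /=; lia.
apply: le_trans (@sum_interval_le R _ 1 2 _ _ _) _ => //; last by rewrite /unit_wt; lra.
move=> l' /andP[/and3P[-> _]]; rewrite (negPf svE) (negPf nls) /=; lia.
Qed.

(** Two letters in {1, 2} that are not both 1 weigh [2 x^3 + x^4], where [x] is
    [unit_wt]; this is less than 1. *)
Lemma low_weight_nonlow v : v \notin E -> sigma v \notin E -> ~~ low v -> low_weight v <= 1.
Proof.
move=> vE svE nlv.
have [sv|sv] := boolP (single v).
  rewrite low_weight_single //; move: sv; rewrite /single (negPf nlv) /= => ->.
  apply: le_trans (@sum_interval_le R _ 2 2 _ _ _) _ => //; last by rewrite /wx; lra.
  move=> l /andP[/and3P[_ _]]; rewrite (negPf vE) (negPf nlv) /=; lia.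
have [lv|lv] := boolP (lead v); last by rewrite low_weight_follow.
have nls : ~~ low (sigma v).
  by move: lv; rewrite /lead (negPf nlv) /=; case: (low (sigma v)).
apply: le_trans (low_weight_lead_le _ _ _ _) _ => //.
apply: le_trans (@sum_interval_split R _ 2 _ _ _ _ _ _) _ => //.
- by move=> l /and3P[-> _]; rewrite (negPf vE) (negPf nlv).
- by rewrite unit_wtX_ge0.
- by rewrite addr_ge0 ?unit_wtX_ge0 ?ltW ?unit_wt_gt0.
by case: ifP => _; rewrite /wx; lra.
Qed.

(** [Z] is at least [x + x^2 + x^3], and [Q] at least [(x^2 + x^3) (x + x^2)],
    where [x] is [unit_wt]. Whether or not the partner under [sigma] is low,
    these values bound the weight of [v] when 1 is allowed, respectively not
    allowed, at [v]. *)
Lemma low_weight_low v : v \notin E -> sigma v \notin E -> low v ->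
  low_weight v <= if S v (inord 1) then Z else Q.
Proof.
move=> vE svE lowv.
have loS1 : low_letters v (inord 1) -> S v (inord 1) by case/and3P.
have [sv|sv] := boolP (single v).
  rewrite low_weight_single //.
  set P := (X in \sum_(l | X l) _).
  apply: le_trans (_ : \sum_(l | low_letters v l) wx ^+ l *
     (if l == 1%N :> nat then 1 else 1) <= _).
    rewrite [leRHS](eq_bigr (fun l : letter => wx ^+ l)); last first.
      by move=> l _; case: ifP => _; rewrite mulr1.
    by apply: sum_sub_le => l; [exact: unit_wtX_ge0|case/andP].
  apply: le_trans (@sum_interval_split R _ 3 _ _ _ _ _ _) _ => //.
    by move=> l /and3P[-> _]; rewrite (negPf vE) lowv.
  case: (boolP (low_letters v _)) => [/loS1 ->|_]; first by rewrite /wx /Z; lra.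
  by case: ifP => _; rewrite /wx /Z /Q; lra.
have nls : ~~ low (sigma v).
  by move: sv; rewrite /single lowv negb_or => /andP[].
have lv : lead v by rewrite /lead lowv (negPf nls).
apply: le_trans (low_weight_lead_le _ _ _ _) _ => //.
apply: le_trans (@sum_interval_split R _ 3 _ _ _ _ _ _) _ => //.
- by move=> l /and3P[-> _]; rewrite (negPf vE) lowv.
- by rewrite unit_wtX_ge0.
- by rewrite addr_ge0 ?unit_wtX_ge0 ?ltW ?unit_wt_gt0.
case: (boolP (low_letters v _)) => [/loS1 ->|_]; first by rewrite /wx /Z; lra.
by case: ifP => _; rewrite /wx /Z /Q; lra.
Qed.

(** Two positions paired by [rho] outside [X] do not both allow the letter 1, and
    [Z * Q < 1]. *)
Lemma low_prod_le : \prod_v low_weight v <= 4 ^+ (#|X| + 4 * #|E|).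
Proof.
pose E1 : {set V} := E :|: [set (c - v)%R | v in E].
pose E2 : {set V} := E1 :|: [set rho v | v in E1].
have cardE1 : (#|E1| <= 2 * #|E|)%N.
  by apply: leq_trans (leq_card_setU _ _) _; rewrite mul2n -addnn leq_add2l leq_imset_card.
have cardE2 : (#|E2| <= 2 * #|E1|)%N.
  by apply: leq_trans (leq_card_setU _ _) _; rewrite mul2n -addnn leq_add2l leq_imset_card.
have inE1 v : v \notin E1 -> v \notin E /\ sigma v \notin E.
  rewrite !inE negb_or => /andP[vE vE']; split => //.
  by apply: contra vE' => tvE; apply/imsetP; exists (c - v)%R; rewrite ?subKr.
have inE2 v : v \notin E2 -> v \notin E1 /\ rho v \notin E1.
  rewrite inE negb_or => /andP[vE vE']; split => //.
  by apply: contra vE' => tvE; apply/imsetP; exists (rho v); rewrite ?rhoK.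
have g0 v : 0 <= low_weight v by case/andP: (low_weight_bounds v).
apply: le_trans (prod_involution (X := X :|: E2) (C := 4) rhoK _ low_weight_bounds _) _.
- by lra.
- move=> v; rewrite inE negb_or => /andP[vX /inE2[/inE1[v1 v2] /inE1[v3 v4]]].
  have [lv|lv] := boolP (low v); last first.
    by rewrite mulr_ile1 ?low_weight_nonlow // low_rho.
  have h1 := low_weight_low v1 v2 lv.
  have h2 : low_weight (rho v) <= _ := low_weight_low v3 v4 (etrans (low_rho v) lv).
  apply: le_trans (ler_pM (g0 _) (g0 _) h1 h2) _.
  case: ifPn => S1; case: ifPn => S2; rewrite /Z /Q; try lra.
  by exfalso; have := XP lv vX S1 S2; rewrite !inordK.
- apply: ler_weXn2l; first by lra.
  by apply: leq_trans (leq_card_setU _ _) _; rewrite leq_add2l; lia.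
Qed.
End Low.
End Products.

(** * Total weight of cyclic words *)

(** The topmost elements of [A] are taken so that, above any of them, the elements
    of [A] all belong to [T]. *)
Lemma top_subset (n d : nat) (A : {set 'I_n}) : (d <= #|A|)%N ->
  exists T : {set 'I_n}, [/\ T \subset A, #|T| = d &
    forall a t, a \in A -> a \notin T -> t \in T -> (a < t)%N].
Proof.
elim: d => [_|d IH dA].
  by exists set0; rewrite sub0set cards0; split=> // a t _ _; rewrite inE.
have [T [TA Td Ttop]] := IH (ltnW dA).
have [a0 a0A] : exists a, a \in A :\: T.
  by apply/set0Pn; rewrite -card_gt0 cardsD (setIidPr TA) Td subn_gt0.
case: (@arg_maxnP _ a0 (mem (A :\: T)) (fun a => a : nat) a0A) => a.
rewrite /= inE => /andP[aT aA] amax.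
exists (a |: T); split; first by rewrite subUset sub1set aA.
  by rewrite cardsU1 aT Td.
move=> u t uA; rewrite !inE negb_or => /andP[ua uT] /predU1P[->|/Ttop]; last exact.
by rewrite ltn_neqAle ua amax //= inE uT.
Qed.

Section Tame.
Variable R : realType.
Local Notation wx := (unit_wt R).
Local Notation letter := 'I_15.

(** The letter [p] is frequent, and no larger one is: a letter counts as frequent
    from [k * k] occurrences on, which is what [few_clashes] needs, and there are
    15 letters. *)
Definition high_word (m k : nat) (f : 'I_m.+1 -> letter) :=
  exists p : letter, [/\ (4 <= p)%N, (forall v, 0 < f v)%N,
    (k * k <= #|[set v | f v == p]|)%N, (#|[set v | p < f v]%N| <= 15 * (k * k))%N &
    forall t, f t = p -> refl_ge p f t].

(** No letter above 3 is frequent enough to provide containers; the reflection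
    [v |-> c - v] makes up for them. *)
Definition low_word (m k : nat) (f : 'I_m.+1 -> letter) :=
  [/\ (forall v, 0 < f v)%N, (#|[set v | 3 < f v]%N| <= 15 * (k * k))%N,
    (exists c : 'I_m.+1, forall v : 'I_m.+1, 3 <= f v + f (c - v)%R)%N &
    forall t, f t = 3%N :> nat -> refl_ge 3 f t].

(** For [lam] close to 1, the powers [lam ^+ (a * m.+1)] stand for the factors
    [exp(o(m))]. The number [k] is chosen after [lam], so large that
    [b ^+ (m / k)] and [4 ^+ (m / k)] are such factors too. *)
Variables (lam b : R) (k : nat).
Hypothesis k0 : (0 < k)%N.
Hypothesis b1 : 1 <= b.
Hypothesis lamE : lam = 1 + b^-1.
Hypothesis lamk4 : 4 <= lam ^+ k.
Hypothesis lamkb : b <= lam ^+ k.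

Lemma lam_ge1 : 1 <= lam.
Proof. by rewrite lamE lerDl invr_ge0 (le_trans _ b1). Qed.

Lemma lam_ge0 : 0 <= lam. Proof. exact: le_trans lam_ge1. Qed.

Lemma pow_le_lam (a : R) (r n : nat) : 0 <= a -> a <= lam ^+ k -> (r * k <= n)%N ->
  a ^+ r <= lam ^+ n.
Proof.
move=> a0 ak rn; apply: le_trans (_ : (lam ^+ k) ^+ r <= _).
  by rewrite lerXn2r ?nnegrE ?exprn_ge0 ?lam_ge0.
by rewrite -exprM mulnC; apply: ler_weXn2l => //; exact: lam_ge1.
Qed.

Definition small (Y : finType) r : {set {set Y}} := [set G : {set Y} | (#|G| <= r)%N].

Lemma card_small (Y : finType) r : #|small Y r|%:R <= b ^+ r * lam ^+ #|Y|.
Proof. by rewrite lamE; exact: card_small_sets. Qed.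

Lemma card_smallF m (Y : finType) r q : #|Y| = (q * m.+1)%N -> (r * k <= 30 * m.+1)%N ->
  #|small Y r|%:R <= lam ^+ ((30 + q) * m.+1).
Proof.
move=> Yq rk; apply: le_trans (card_small _ _) _.
rewrite mulnDl exprD Yq; apply: ler_wpM2r; first by rewrite exprn_ge0 ?lam_ge0.
by apply: pow_le_lam => //; exact: le_trans b1.
Qed.

Lemma natr_le_lam m : (m.+1)%:R <= b * lam ^+ m.+1.
Proof.
have b0 : 0 < b by apply: lt_le_trans b1.
rewrite -ler_pdivrMl // mulrC lamE.
apply: le_trans (bernoulli_ineq m.+1 _); last by rewrite invr_ge0 ltW.
by rewrite lerDr ler01.
Qed.

Lemma card_data m (P : {set 'I_m.+1 * ({set 'I_m.+1} * {set 'I_m.+1})}) :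
  P = setX setT (setX (small _ (k * k)) (small _ (16 * (k * k)))) ->
  #|P|%:R <= b * (b ^+ (17 * (k * k)) * lam ^+ (3 * m.+1)).
Proof.
move=> ->; rewrite !cardsX cardsT card_ord !natrM.
have hT := card_small 'I_m.+1 (k * k); have hE := card_small 'I_m.+1 (16 * (k * k)).
rewrite card_ord in hT hE.
apply: le_trans (ler_pM _ _ (natr_le_lam m) (ler_pM _ _ hT hE)) _ => //.
rewrite (_ : (17 * (k * k) = k * k + 16 * (k * k))%N); last by lia.
rewrite (_ : (3 * m.+1 = m.+1 + m.+1 + m.+1)%N); last by lia.
by rewrite !exprD le_eqVlt; apply/orP; left; apply/eqP; ring.
Qed.

Let container_cost := 15%:R * (b * b) * b ^+ (17 * (k * k)) * 4 ^+ (64 * (k * k)).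

Lemma card_above m (f : 'I_m.+1 -> letter) (p : nat) (T E : {set 'I_m.+1}) :
  (#|[set v | p < f v]%N| <= 15 * (k * k))%N -> (#|T| <= k * k)%N ->
  E = [set v | p < f v]%N :|: T -> (#|E| <= 16 * (k * k))%N.
Proof.
move=> fp Tk ->; apply: leq_trans (leq_card_setU _ _) _.
by apply: leq_trans (leq_add fp Tk) _; lia.
Qed.

Lemma prod_wx_ge0 m (f : 'I_m.+1 -> letter) : 0 <= \prod_v wx ^+ f v.
Proof. by apply: prodr_ge0 => v _; apply: unit_wtX_ge0. Qed.

(** The containers are indexed by the frequent letter [p], the set [T] of its
    topmost occurrences, a reflection centre [t] in [T], the exceptions [E], and
    the fingerprint [F]. There are [exp(o(m))] of them, and each has total weight
    [exp(o(m))]. *)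
Lemma high_weight m :
  \sum_(f : {ffun 'I_m.+1 -> letter} | `[< high_word k f >]) \prod_v wx ^+ f v
    <= container_cost * lam ^+ (50 * m.+1).
Proof.
pose sTE := setX [set: 'I_m.+1] (setX (small 'I_m.+1 (k * k)) (small 'I_m.+1 (16 * (k * k)))).
pose r := (30 * m.+1 %/ k)%N.
pose P := setX sTE (setX [set p : letter | 4 <= p]%N (small ('I_m.+1 * letter)%type r)).
pose W' (d : 'I_m.+1 * ({set 'I_m.+1} * {set 'I_m.+1}) * (letter * {set 'I_m.+1 * letter})) :
    pred {ffun 'I_m.+1 -> letter} :=
  let: ((t, (T, E)), (p, F)) := d in
  fun f => (#|clash T F k p t| * k <= m.+1)%N &&
    [forall v, high_letters T F k p t E v (f v)].
pose M : R := lam ^+ m.+1 * 4 ^+ (32 * (k * k)).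
apply: le_trans (union_bound (P := mem P) (W' := W') (M := M) _ _ _) _.
- by move=> f; apply: prod_wx_ge0.
- move=> f /asboolP[p [p4 f0 fp fmore fp_ge]].
  have [T [Tsub Tk Ttop]] := top_subset fp.
  have Tge : {in T, forall t, refl_ge p f t}.
    by move=> t /(subsetP Tsub); rewrite inE => /eqP; apply: fp_ge.
  have [F [Fk Fal]] := fingerprint_allowed k0 Tge.
  have [t tT tk] := few_clashes F p Tk k0.
  exists ((t, (T, [set v | p < f v]%N :|: T)), (p, F)).
    rewrite !inE /= Tk leqnn p4 /= leq_divRL // Fk andbT.
    by apply: (card_above fmore _ erefl); rewrite Tk.
  rewrite /W' tk /=; apply/forallP => v; rewrite /high_letters f0 Fal /=.
  rewrite !inE; have [//|fpv] := ltnP p (f v).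
  have [//|vT] /= := boolP (v \in T).
  have [tv|_] := ltnP t v; last by rewrite addn0.
  (* Above [t], a letter [p] outside [T] would contradict the choice of [T] as topmost. *)
  rewrite addn1 ltn_neqAle fpv andbT; apply/negP => /eqP fvp.
  have := Ttop v t _ vT tT; rewrite inE -val_eqE /= fvp eqxx => /(_ isT); lia.
- case=> [[t [T E]] [p F]]; rewrite !inE /= => /andP[/andP[_ Ek] /andP[p4 _]].
  case ck : (#|clash T F k p t| * k <= m.+1)%N; last first.
    by rewrite big_pred0 // mulr_ge0 ?exprn_ge0 ?lam_ge0.
  apply: le_trans (sum_words_le (w := fun l : letter => wx ^+ l)
     (L := high_letters T F k p t E) _ _) _.
  + by move=> l; apply: unit_wtX_ge0.
  + by move=> f /= /forallP.
  apply: le_trans (high_prod_le _ _ _ _ _ _ _) _; first by rewrite p4 -ltnS ltn_ord.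
  rewrite exprD; apply: ler_pM; rewrite ?exprn_ge0 //.
    by apply: pow_le_lam => //; apply: le_trans lamk4; lra.
  apply: le_trans (_ : 2 ^+ (32 * (k * k)) <= _).
    by apply: ler_weXn2l; [lra|rewrite (_ : 32 = 2 * 16)%N // -mulnA leq_mul2l Ek].
  by apply: lerXn2r; rewrite ?nnegrE; lra.
have cF : #|small ('I_m.+1 * letter)%type r|%:R <= lam ^+ (45 * m.+1).
  apply: (@card_smallF m _ r 15); last exact: leq_divM.
  by rewrite card_prod !card_ord mulnC.
have cTE := card_data (erefl sTE).
have cp : (#|[set p : letter | 4 <= p]%N|)%:R <= 15%:R :> R.
  by rewrite ler_nat; apply: leq_trans (max_card _) _; rewrite card_ord.
rewrite (_ : #|mem P| = #|P|) // cardsX [in X in (_ * X)%N]cardsX !natrM.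
apply: le_trans (ler_wpM2r _ (ler_pM _ _ cTE (ler_pM _ _ cp cF))) _ => //.
- by rewrite mulr_ge0 ?exprn_ge0 ?lam_ge0.
have b0 : 0 <= b by apply: le_trans b1.
rewrite /M /container_cost (_ : (50 * m.+1 = 3 * m.+1 + 45 * m.+1 + m.+1 + m.+1)%N); last by lia.
rewrite (_ : (64 * (k * k) = 32 * (k * k) + 32 * (k * k))%N); last by lia.
have h1 : 1 <= b * lam ^+ m.+1 * 4 ^+ (32 * (k * k)).
  by rewrite !mulr_ege1 ?exprn_ege1 ?lam_ge1 //; lra.
rewrite 3!(exprD lam) (exprD 4).
set A := b ^+ (17 * _); set B := lam ^+ (3 * _); set C := lam ^+ (45 * _).
set D := lam ^+ m.+1 in h1 *; set G := 4 ^+ _ in h1 *.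
rewrite [leRHS](_ : _ = b * (A * B) * (15%:R * C) * (D * G) * (b * D * G)); last by ring.
by rewrite ler_peMr // !mulr_ge0 ?exprn_ge0 ?lam_ge0.
Qed.

Definition pair_code m (low : pred 'I_m.+1) (c : 'I_m.+1) (f : 'I_m.+1 -> letter) v :=
  if single low c v then (f v, ord0)
  else if lead low c v then (f v, f (c - v)%R) else (ord0, ord0).

Lemma low_sum_le m (S : 'I_m.+1 -> pred letter) (low : pred 'I_m.+1) rho (E X : {set 'I_m.+1}) c :
  involutive rho -> (forall v, low (rho v) = low v) ->
  (forall v, low v -> v \notin X -> forall l l', S v l -> S (rho v) l' -> (3 <= l + l')%N) ->
  \sum_(f : {ffun 'I_m.+1 -> letter} |
      [forall v, low_pairs S low E c v (pair_code low c f v)]) \prod_v wx ^+ f v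
    <= 4 ^+ (#|X| + 4 * #|E|).
Proof.
move=> rhoK low_rho XP.
apply: le_trans (low_prod_le R E c rhoK low_rho XP).
have singleC v : single low c (c - v) = single low c v.
  by rewrite /single subKr andbC (eq_sym v).
apply: (sum_words_pairs (l0 := ord0) (w := fun l : letter => wx ^+ l)
  (sigma := fun v => (c - v)%R)) => //.
- by move=> l; apply: unit_wtX_ge0.
- exact: refl_involutive.
- move=> v; rewrite /single /lead subKr negb_or.
  case: (low v) (low (c - v)%R) => -[] //= => cv.
  by rewrite -leqNgt ltn_neqAle; case: eqP => // e; case/eqP: cv; apply/val_inj.
- by move=> f /forallP.
Qed.

Lemma low_pairs_code m (S : 'I_m.+1 -> pred letter) (low : pred 'I_m.+1)
    (E : {set 'I_m.+1}) c (f : 'I_m.+1 -> letter) :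
  (forall v, 0 < f v)%N -> (forall v, S v (f v)) ->
  (forall v, (v \in E) || (f v <= if low v then 3 else 2)%N) ->
  (forall v, 3 <= f v + f (c - v)%R)%N ->
  [forall v, low_pairs S low E c v (pair_code low c f v)].
Proof.
move=> f0 fS fE fc.
have fl v : low_letters S low E v (f v) by rewrite /low_letters f0 fS fE.
apply/forallP => v; rewrite /pair_code /low_pairs.
have [sv|/negPf sv] := boolP (single low c v); rewrite ?sv.
  rewrite eqxx andbT; apply/andP; split; first exact: fl.
  by apply/implyP => /eqP vE; have := fc v; rewrite vE.
have [lv|/negPf lv] := boolP (lead low c v); rewrite ?lv //.
by apply/andP; split; [exact: fl|apply/andP; split; [exact: fl|exact: fc]].
Qed.

(** When the letter 3 is frequent, containers are taken for [p = 3] with centre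
    [t], and the low positions are those up to [t]. *)
Lemma low_weight_many m :
  \sum_(f : {ffun 'I_m.+1 -> letter} |
      `[< low_word k f /\ (k * k <= #|[set v | f v == 3%N :> nat]|)%N >]) \prod_v wx ^+ f v
    <= container_cost * b * lam ^+ (51 * m.+1).
Proof.
pose sTE := setX [set: 'I_m.+1] (setX (small 'I_m.+1 (k * k)) (small 'I_m.+1 (16 * (k * k)))).
pose r := (30 * m.+1 %/ k)%N.
pose P := setX sTE (setX [set: 'I_m.+1] (small ('I_m.+1 * letter)%type r)).
pose low (t : 'I_m.+1) : pred 'I_m.+1 := fun v => (v <= t)%N.
pose W' (d : 'I_m.+1 * ({set 'I_m.+1} * {set 'I_m.+1}) * ('I_m.+1 * {set 'I_m.+1 * letter})) :
    pred {ffun 'I_m.+1 -> letter} :=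
  let: ((t, (T, E)), (c, F)) := d in
  fun f => (#|clash T F k 3 t| * k <= m.+1)%N &&
    [forall v, low_pairs (allowed T F k 3) (low t) E c v (pair_code (low t) c f v)].
pose M : R := lam ^+ m.+1 * 4 ^+ (64 * (k * k)).
apply: le_trans (union_bound (P := mem P) (W' := W') (M := M) _ _ _) _.
- by move=> f; apply: prod_wx_ge0.
- move=> f /asboolP[[f0 fmore [c fc] fp_ge] fp].
  have [T [Tsub Tk Ttop]] := top_subset fp.
  have Tge : {in T, forall t, refl_ge 3 f t}.
    by move=> t /(subsetP Tsub); rewrite inE => /eqP; apply: fp_ge.
  have [F [Fk Fal]] := fingerprint_allowed k0 Tge.
  have [t tT tk] := few_clashes F 3 Tk k0.
  exists ((t, (T, [set v | 3 < f v]%N :|: T)), (c, F)).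
    rewrite !inE /= Tk leqnn /= leq_divRL // Fk andbT.
    by apply: (card_above fmore _ erefl); rewrite Tk.
  rewrite /W' tk /=; apply: low_pairs_code => // v.
  rewrite !inE; have [//|fpv] := ltnP 3 (f v).
  have [//|vT] /= := boolP (v \in T).
  rewrite /low; have [//|tv] := leqP v t.
  rewrite -ltnS ltn_neqAle fpv andbT; apply/negP => /eqP fvp.
  have := Ttop v t _ vT tT; rewrite inE fvp eqxx => /(_ isT); lia.
- case=> [[t [T E]] [c F]]; rewrite !inE /= => /andP[/andP[_ Ek] _].
  case ck : (#|clash T F k 3 t| * k <= m.+1)%N; last first.
    by rewrite big_pred0 // mulr_ge0 ?exprn_ge0 ?lam_ge0.
  apply: le_trans (low_sum_le (X := clash T F k 3 t) E c (@refl_involutive m t) _ _) _.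
  + by move=> v; rewrite /low [LHS]leqNgt [RHS]leqNgt ltn_refl.
  + rewrite /low => v vt vX l l' al al'; rewrite leqNgt; apply: contra vX => sm.
    rewrite inE; apply/existsP; exists l; apply/existsP; exists l'.
    by rewrite al al' /= (ltnNge t v) vt addn0.
  rewrite exprD; apply: ler_pM; rewrite ?exprn_ge0 //.
    by apply: pow_le_lam => //; lra.
  by apply: ler_weXn2l; [lra|rewrite (_ : 64 = 4 * 16)%N // -mulnA leq_mul2l Ek].
have cF : #|small ('I_m.+1 * letter)%type r|%:R <= lam ^+ (45 * m.+1).
  apply: (@card_smallF m _ r 15); last exact: leq_divM.
  by rewrite card_prod !card_ord mulnC.
have cTE := card_data (erefl sTE).
have cc : (#|[set: 'I_m.+1]|)%:R <= b * lam ^+ m.+1.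
  by rewrite cardsT card_ord; apply: natr_le_lam.
have b0 : 0 <= b by apply: le_trans b1.
rewrite (_ : #|mem P| = #|P|) // cardsX [in X in (_ * X)%N]cardsX !natrM.
apply: le_trans (ler_wpM2r _ (ler_pM _ _ cTE (ler_pM _ _ cc cF))) _ => //.
- by rewrite mulr_ge0 ?exprn_ge0 ?lam_ge0.
rewrite /M /container_cost.
rewrite (_ : (51 * m.+1 = 3 * m.+1 + 45 * m.+1 + m.+1 + m.+1 + m.+1)%N); last by lia.
have h1 : 1 <= 15%:R * b * lam ^+ m.+1.
  by rewrite !mulr_ege1 ?exprn_ege1 ?lam_ge1 //; lra.
rewrite 4!(exprD lam).
set A := b ^+ (17 * _); set B := lam ^+ (3 * _); set C := lam ^+ (45 * _).
set D := lam ^+ m.+1 in h1 *; set G := 4 ^+ _ in h1 *.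
rewrite [leRHS](_ : _ = b * (A * B) * (b * D * C) * (D * G) * (15%:R * b * D)); last by ring.
by rewrite ler_peMr // !mulr_ge0 ?exprn_ge0 ?lam_ge0.
Qed.

(** When the letter 3 is rare too, its occurrences join the exceptions and no
    position is low, so that [sigma] alone suffices. *)
Lemma low_weight_few m :
  \sum_(f : {ffun 'I_m.+1 -> letter} |
      `[< low_word k f /\ (#|[set v | f v == 3%N :> nat]| < k * k)%N >]) \prod_v wx ^+ f v
    <= container_cost * lam ^+ (50 * m.+1).
Proof.
pose P := setX [set: 'I_m.+1] (small 'I_m.+1 (16 * (k * k))).
pose W' (d : 'I_m.+1 * {set 'I_m.+1}) : pred {ffun 'I_m.+1 -> letter} :=
  fun f => [forall v, low_pairs (fun _ _ => true) pred0 d.2 d.1 v (pair_code pred0 d.1 f v)].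
pose M : R := 4 ^+ (64 * (k * k)).
apply: le_trans (union_bound (P := mem P) (W' := W') (M := M) _ _ _) _.
- by move=> f; apply: prod_wx_ge0.
- move=> f /asboolP[[f0 fmore [c fc] _] /ltnW fp].
  exists (c, [set v | 3 < f v]%N :|: [set v | f v == 3%N :> nat]).
    by rewrite !inE /=; apply: (card_above fmore fp).
  by apply: low_pairs_code => // v; rewrite !inE /=; case: (ltngtP (f v) 3%N) => //; rewrite ?orbT.
- case=> [c E]; rewrite !inE /= => Ek.
  apply: le_trans (low_sum_le (X := set0) (rho := id) E c _ _ _) _ => //.
  rewrite cards0 add0n.
  by apply: ler_weXn2l; [lra|rewrite (_ : 64 = 4 * 16)%N // -mulnA leq_mul2l Ek].
have hE := card_small 'I_m.+1 (16 * (k * k)); rewrite card_ord in hE.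
rewrite (_ : #|mem P| = #|P|) // cardsX cardsT card_ord !natrM.
have M0 : 0 <= M by apply: exprn_ge0.
apply: le_trans (ler_wpM2r M0 (ler_pM _ _ (natr_le_lam m) hE)) _ => //.
have b0 : 0 <= b by apply: le_trans b1.
rewrite /M /container_cost (_ : (50 * m.+1 = m.+1 + m.+1 + 48 * m.+1)%N); last by lia.
rewrite (_ : (17 * (k * k) = 16 * (k * k) + k * k)%N); last by lia.
have h1 : 1 <= 15%:R * b * b ^+ (k * k) * lam ^+ (48 * m.+1).
  by rewrite !mulr_ege1 ?exprn_ege1 ?lam_ge1 //; lra.
rewrite 2!(exprD lam) (exprD b (16 * _)).
set A := b ^+ (16 * _); set A' := b ^+ (k * k) in h1 *; set B := lam ^+ m.+1.
set C := lam ^+ (48 * _) in h1 *; set G := 4 ^+ _ in h1 *.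
rewrite [leRHS](_ : _ = b * B * (A * B) * G * (15%:R * b * A' * C)); last by ring.
by rewrite ler_peMr // !mulr_ge0 ?exprn_ge0 ?lam_ge0.
Qed.
End Tame.

(** * From weights to numbers of words *)

Definition word_ffun (K n : nat) (w : seq nat) : {ffun 'I_n -> 'I_K.+1} :=
  [ffun i : 'I_n => inord (nth 0%N w i)].

Lemma word_ffunE K n w (i : 'I_n) : size w = n -> all (fun a => a <= K)%N w ->
  word_ffun K n w i = nth 0%N w i :> nat.
Proof.
move=> wn /all_nthP wK; rewrite ffunE inordK // ltnS.
by have := wK 0%N i; rewrite wn ltn_ord; apply.
Qed.

Lemma sumn_nth (w : seq nat) : (\sum_(i < size w) nth 0 w i = sumn w)%N.
Proof. by rewrite sumnE (big_nth 0%N) big_mkord. Qed.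

(** Every word of sum [g] has weight [z ^+ g]. *)
Lemma count_le_weight (R : realType) (s : seq (seq nat)) (n K g : nat) (z : R)
    (W : pred {ffun 'I_n -> 'I_K.+1}) : 0 <= z -> uniq s ->
  (forall w, w \in s ->
    [/\ size w = n, all (fun a => a <= K)%N w, sumn w = g & W (word_ffun K n w)]) ->
  (size s)%:R * z ^+ g <= \sum_(f | W f) \prod_i z ^+ f i.
Proof.
move=> z0 us sP.
have inj : {in s &, injective (word_ffun K n)}.
  move=> w w' /sP[wn wK _ _] /sP[wn' wK' _ _] /ffunP e.
  apply: (@eq_from_nth _ 0%N) => [|i]; first by rewrite wn wn'.
  rewrite wn => i_n; have /(congr1 val) := e (Ordinal i_n).
  by rewrite /= !word_ffunE.
pose S := [seq word_ffun K n w | w <- s].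
have uS : uniq S by rewrite map_inj_in_uniq.
apply: le_trans (_ : \sum_(f in S) \prod_i z ^+ f i <= _); last first.
  apply: sum_sub_le => [f|f /mapP[w /sP[_ _ _ Ww] ->] //].
  by apply: prodr_ge0 => i _; apply: exprn_ge0.
rewrite -big_uniq //= big_map big_seq (eq_bigr (fun=> z ^+ g)); last first.
  move=> w /sP[wn wK wg _]; rewrite prodrXr -wg -sumn_nth wn; congr (_ ^+ _).
  by apply: eq_bigr => i _; rewrite word_ffunE.
by rewrite -big_seq big_const_seq count_predT iter_addr addr0 mulr_natl.
Qed.

Lemma size_by_length (s : seq (seq nat)) (g : nat) :
  (forall w, w \in s -> size w <= g)%N ->
  size s = (\sum_(n < g.+1) size [seq w <- s | size w == n])%N.
Proof.
move=> sg; rewrite -(big_mkord xpredT (fun n => size [seq w <- s | size w == n])).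
under eq_bigr do rewrite size_filter -sum1_count.
rewrite (exchange_big_dep xpredT) //= -sum1_size big_seq [RHS]big_seq.
apply: eq_bigr => w /sg wg.
by rewrite big_mkord (big_pred1 (Ordinal (wg : size w < g.+1)%N)).
Qed.

Lemma count_above m (f : 'I_m -> 'I_15) (p d : nat) :
  (forall q : 'I_15, p < q -> #|[set v | f v == q]%SET| < d)%N ->
  (#|[set v | p < f v]%SET| <= 15 * d)%N.
Proof.
move=> fd; rewrite -sum1_card (partition_big f (fun q : 'I_15 => p < q)%N) /=; last first.
  by move=> v; rewrite inE.
apply: leq_trans (_ : \sum_(q < 15 | p < q) d <= _)%N.
  apply: leq_sum => q pq; apply: ltnW; apply: leq_ltn_trans (fd q pq).
  rewrite sum1dep_card; apply: subset_leq_card; apply/fintype.subsetP => v.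
  by rewrite !inE => /andP[].
rewrite sum_nat_const leq_mul2r; apply/orP; right.
by apply: leq_trans (max_card _) _; rewrite card_ord.
Qed.

Section Growth.
Variable R : realType.
Local Notation wx := (unit_wt R).
(** A number less than the claimed growth rate, and greater than [17 / 11], the
    inverse of [unit_wt]. *)
Definition rate : R := 1549%:R / 1000%:R.

(** The exponent is 52 because the containers cost at most 51 powers of [lam] per
    position, and the number of possible lengths costs one more. *)
Lemma exists_lam : exists lam b : R, exists k : nat, [/\ (0 < k)%N, 1 <= b, lam = 1 + b^-1,
  4 <= lam ^+ k /\ b <= lam ^+ k & lam ^+ 52 <= rate * wx].
Proof.
have mu1 : 1 < rate * wx by rewrite /rate /wx; lra.
have mu0 : 0 < rate * wx by apply: lt_trans mu1.
have mu2 : rate * wx < 2 by rewrite /rate /wx; lra.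
pose lam := (rate * wx) `^ (52%:R^-1).
have lam0 : 0 <= lam by apply: powR_ge0.
have lamE : lam ^+ 52 = rate * wx.
  by rewrite -powR_mulrn // -powRrM mulVf ?pnatr_eq0 // powRr1 // ltW.
have lam1 : 1 < lam.
  rewrite ltNge; apply/negP => l1; have := exprn_ile1 52 lam0 l1.
  by rewrite lamE leNgt mu1.
have lam2 : lam <= 2.
  apply: le_trans (ltW mu2); rewrite -lamE exprS ler_peMr //.
  by rewrite exprn_ege1 // ltW.
pose b := (lam - 1)^-1.
have b1 : 1 <= b by rewrite invf_ge1 ?subr_gt0 // lerBlDr.
have lamb : lam = 1 + b^-1 by rewrite invrK addrC subrK.
pose k := (Num.bound (b * (4 + b))).+1.
have b0 : 0 < b by apply: lt_le_trans b1.
have bk : 4 + b <= lam ^+ k.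
  rewrite -(ler_pM2l b0); apply: le_trans (natr_le_lam b1 lamb _).
  apply: ltW; apply: lt_le_trans (archi_boundP _) _; last by rewrite ler_nat.
  by rewrite mulr_ge0 ?addr_ge0 ?ltW.
exists lam, b, k; split => //; last by rewrite lamE.
by split; apply: le_trans bk; lra.
Qed.

(** Position 0 of a cyclic word carries no Kunz coordinate. The filler 3 put there
    makes the inequalities of [high_word] and [low_word] hold at 0 as well. *)
Lemma tame_growth : exists k : nat, (0 < k)%N /\ exists2 C : R, 0 <= C &
  forall (g : nat) (s : seq (seq nat)), uniq s ->
  (forall w, w \in s -> [/\ all (fun a => a <= 14)%N w, (size w <= g)%N, sumn w = g &
     let f := word_ffun 14 (size w).+1 (3 :: w)%N in high_word k f \/ low_word k f]) ->
  (size s)%:R <= C * rate ^+ g.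
Proof.
have [lam [b [k [k0 b1 lamE [lamk4 lamkb] lam52]]]] := exists_lam.
exists k; split=> //.
have [c cE] : exists c : R,
  c = 15%:R * (b * b) * b ^+ (17 * (k * k)) * 4 ^+ (64 * (k * k)) by eexists.
have b0 : 0 < b by apply: lt_le_trans b1.
have c0 : 0 <= c by rewrite cE !mulr_ge0 ?exprn_ge0 // ltW.
have lam1 := lam_ge1 b1 lamE; have lam0 := lam_ge0 b1 lamE.
have [D DE] : exists D : R, D = (c + c * b + c) * b by eexists.
have b0' := ltW b0; have D0 : 0 <= D by rewrite DE mulr_ge0 ?addr_ge0 ?mulr_ge0.
exists (D * lam ^+ 52 * wx ^- 3).
  by rewrite !mulr_ge0 ?invr_ge0 ?exprn_ge0 ?(ltW (unit_wt_gt0 R)).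
move=> g s us sP.
pose sn n := [seq w <- s | size w == n].
have size_s : size s = (\sum_(n < g.+1) size (sn n))%N.
  by apply: size_by_length => w /sP[].
have hn n : (n <= g)%N -> (size (sn n))%:R * wx ^+ (3 + g) <= (c + c * b + c) * lam ^+ (51 * g.+1).
  move=> ng; pose s' := [seq (3 :: w)%N | w <- sn n].
  pose W (f : {ffun 'I_n.+1 -> 'I_15}) := `[< high_word k f \/ low_word k f >].
  have -> : size (sn n) = size s' by rewrite size_map.
  apply: le_trans (@count_le_weight R s' n.+1 14 (3 + g) wx W _ _ _) _.
  - by rewrite ltW // unit_wt_gt0.
  - by rewrite map_inj_uniq ?filter_uniq // => u u' [].
  - move=> _ /mapP[w ws ->]; move: ws; rewrite mem_filter => /andP[/eqP wn /sP[w14 _ wg Ww]].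
    by rewrite /= w14 wn wg; split=> //; apply/asboolP; rewrite -wn.
  pose W1 (f : {ffun 'I_n.+1 -> 'I_15}) := `[< high_word k f >].
  pose W2 (f : {ffun 'I_n.+1 -> 'I_15}) := `[< low_word k f /\
     (k * k <= #|[set v | f v == 3%N :> nat]%SET|)%N >].
  pose W3 (f : {ffun 'I_n.+1 -> 'I_15}) := `[< low_word k f /\
     (#|[set v | f v == 3%N :> nat]%SET| < k * k)%N >].
  pose w (f : {ffun 'I_n.+1 -> 'I_15}) : R := \prod_v wx ^+ f v.
  have w0 f : 0 <= w f by apply: prod_wx_ge0.
  have h1 := high_weight k0 b1 lamE lamk4 lamkb n.
  have h2 := low_weight_many k0 b1 lamE lamk4 lamkb n.
  have h3 := low_weight_few k0 b1 lamE lamk4 lamkb n.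
  rewrite -cE in h1 h2 h3.
  have lamn (i j : nat) : (i <= 51)%N -> lam ^+ (i * n.+1) <= lam ^+ (51 * g.+1).
    by move=> i51; apply: ler_weXn2l => //; apply: leq_mul.
  apply: le_trans (@sum_or_le R _ W W1 (fun f => W2 f || W3 f) w w0 _) _.
    move=> f /asboolP[hf|lf]; first by apply/orP; left; apply/asboolP.
    apply/orP; right; apply/orP.
    case: (leqP (k * k) #|[set v | f v == 3%N :> nat]%SET|) => h.
      by left; apply/asboolP.
    by right; apply/asboolP.
  rewrite !mulrDl -addrA; apply: lerD.
    by apply: le_trans h1 _; apply: ler_wpM2l => //; apply: lamn.
  apply: le_trans (@sum_or_le R _ _ W2 W3 w w0 _) _ => //.
  apply: lerD.
    by apply: le_trans h2 _; apply: ler_wpM2l; [rewrite mulr_ge0 // ltW|apply: lamn].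
  by apply: le_trans h3 _; apply: ler_wpM2l => //; apply: lamn.
have wx0 := unit_wt_gt0 R.
have wxn0 n : wx ^+ n != 0 by rewrite expf_neq0 // gt_eqF.
have hs : (size s)%:R * wx ^+ (3 + g) <= (g.+1)%:R * ((c + c * b + c) * lam ^+ (51 * g.+1)).
  rewrite size_s natr_sum mulr_suml -[X in X%:R * _]card_ord mulr_natl -sumr_const.
  by apply: ler_sum => n _; apply: hn; rewrite -ltnS.
have hs2 : (size s)%:R * wx ^+ (3 + g) <= D * (lam ^+ 52) ^+ g.+1.
  have e : (52 * g.+1 = 51 * g.+1 + g.+1)%N by rewrite -[X in (_ = _ + X)%N]mul1n -mulnDl.
  apply: le_trans hs _; rewrite -exprM e exprD DE -!mulrA mulrCA.
  rewrite ler_wpM2l ?addr_ge0 ?mulr_ge0 //.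
  rewrite [leLHS]mulrC [leRHS]mulrCA ler_wpM2l ?exprn_ge0 //.
  exact: (natr_le_lam b1 lamE).
rewrite -(ler_pM2r (exprn_gt0 (3 + g) wx0)); apply: le_trans hs2 _.
have L0 : 0 <= lam ^+ 52 by apply: exprn_ge0.
move: (lam ^+ 52) lam52 L0 => L Lrho L0; rewrite exprS mulrA.
rewrite [leRHS](_ : _ = D * L * (rate ^+ g * wx ^+ g)); last first.
  rewrite exprD; move: (wx ^+ 3) (wxn0 3) => x3 x30.
  by move: (rate ^+ g) (wx ^+ g) => u v; field.
rewrite -exprMn; apply: ler_wpM2l; first by rewrite mulr_ge0.
by apply: lerXn2r => //; rewrite nnegrE // (le_trans L0).
Qed.

(** Words this short in comparison with their sum are few: with weight [z = 6 / 7]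
    per unit, the words of length [n] and sum [g] number at most
    [6 ^ n (7 / 6) ^ g], and [6 <= (13 / 10) ^ 7] absorbs the first factor. *)
Lemma long_growth : exists2 C : R, 0 <= C &
  forall (g : nat) (s : seq (seq nat)), uniq s ->
  (forall w, w \in s -> [/\ all_pos w, sumn w = g & (7 * (size w).+1 <= g)%N]) ->
  (size s)%:R <= C * rate ^+ g.
Proof.
exists 101%:R; first by lra.
move=> g s us sP; pose z : R := 6%:R / 7%:R.
have z0 : 0 < z by rewrite /z; lra.
pose y : R := 13%:R / 10%:R.
have geom : \sum_(l < g.+1 | (0 < l)%N) z ^+ l = 6%:R - 6%:R * z ^+ g.
  elim: g {s us sP} => [|n IH].
    by rewrite big_mkcond big_ord_recl big_ord0 /= expr0; lra.
  rewrite big_mkcond big_ord_recr /= -big_mkcond IH exprS; move: (z ^+ n) => u.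
  rewrite /z; lra.
have hn n : (size [seq w <- s | size w == n])%:R * z ^+ g <= y ^+ g.
  have y1 : 1 <= y by rewrite /y; lra.
  case: (leqP (7 * n) g) => [ng|ng]; last first.
    rewrite (_ : [seq w <- s | size w == n] = [::]) ?mul0r ?exprn_ge0 ?(le_trans ler01) //.
    apply/eqP; rewrite -size_eq0 size_filter -leqn0 leqNgt -has_count.
    by apply/hasPn => w /sP[_ _ wg]; apply/eqP => wn; move: ng wg; rewrite wn; lia.
  pose W (f : {ffun 'I_n -> 'I_g.+1}) := [forall i, (0 < f i)%N].
  apply: le_trans (@count_le_weight R _ n g g z W (ltW z0) _ _) _.
  - exact: filter_uniq.
  - move=> w; rewrite mem_filter => /andP[/eqP wn /sP[w0 wg _]].
    have wK : all (fun a => a <= g)%N w.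
      by apply/allP => a aw; rewrite -wg sumnE (big_rem a) //= leq_addr.
    split=> //; apply/forallP => i; rewrite word_ffunE //.
    by have /all_nthP := w0; apply; rewrite wn.
  apply: le_trans (sum_words_le (w := fun l : 'I_g.+1 => z ^+ l) (L := fun _ l => (0 < l)%N) _ _) _.
  - by move=> l; rewrite exprn_ge0 // ltW.
  - by move=> f /forallP.
  rewrite prodr_const card_ord geom.
  apply: le_trans (_ : (y ^+ 7) ^+ n <= _); last first.
    by rewrite -exprM; apply: ler_weXn2l.
  have zg : 0 <= z ^+ g <= 1.
    by rewrite exprn_ge0 ?exprn_ile1 ?ltW // /z; lra.
  apply: lerXn2r; rewrite ?nnegrE; first by move: (z ^+ g) zg => u; lra.
    by rewrite exprn_ge0 // (le_trans ler01).
  by move: (z ^+ g) zg => u zg; rewrite /y; lra.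
have hs : (size s)%:R * z ^+ g <= (g.+1)%:R * y ^+ g.
  rewrite (@size_by_length s g); last by move=> w /sP[_ _]; lia.
  rewrite natr_sum mulr_suml -[X in X%:R * _]card_ord mulr_natl -sumr_const.
  by apply: ler_sum => n _; apply: hn.
rewrite -(ler_pM2r (exprn_gt0 g z0)); apply: le_trans hs _.
pose l : R := 101%:R / 100%:R.
have hl : (g.+1)%:R <= 101%:R * l ^+ g.
  apply: le_trans (@natr_le_lam R l 100%:R _ _ g) _; rewrite /l; try lra.
  by rewrite exprS mulrA ler_wpM2r ?exprn_ge0 //; lra.
have y0 : 0 <= y by rewrite /y; lra.
apply: le_trans (ler_wpM2r (exprn_ge0 g y0) hl) _.
rewrite -!mulrA -!exprMn; apply: ler_wpM2l; first by lra.
by apply: lerXn2r; rewrite ?nnegrE /l /y /z /rate; lra.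
Qed.
End Growth.

(** * Kunz words as cyclic words *)

(** Numbered from 1, the letters of [w] are the Kunz coordinates of the nonzero
    residues; the residue 0 has coordinate 0. *)
Definition kcoord (w : seq nat) (i : nat) : nat := nth 0%N (0%N :: w) i.

Definition kunz (w : seq nat) : Prop := forall i j, (i <= size w)%N -> (j <= size w)%N ->
  (kcoord w ((i + j) %% (size w).+1) <= kcoord w i + kcoord w j + ((size w).+1 <= i + j))%N.

(** The Kunz inequalities for the pairs that do not wrap around. They do not
    involve the length of the word, and suffice for letters at most 3. *)
Definition direct (w : seq nat) : Prop := forall i j, (i + j <= size w)%N ->
  (kcoord w (i + j) <= kcoord w i + kcoord w j)%N.

Lemma kunz_direct w : kunz w -> direct w.
Proof.
move=> kw i j ij; have := kw i j; rewrite modn_small //.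
by rewrite ltnNge ij addn0; apply; apply: leq_trans ij; rewrite ?leq_addr ?leq_addl.
Qed.

Lemma kcoord_rcons w c i : (i <= size w)%N -> kcoord (rcons w c) i = kcoord w i.
Proof. by case: i => [//|i] iw; rewrite /kcoord /= nth_rcons iw. Qed.

Lemma kcoord_rcons_last w c : kcoord (rcons w c) (size w).+1 = c.
Proof. by rewrite /kcoord /= nth_rcons ltnn eqxx. Qed.

Lemma kcoord_gt0 w i : all_pos w -> (0 < i <= size w)%N -> (0 < kcoord w i)%N.
Proof. by move=> /all_nthP w0; case: i => [//|i] /andP[_ iw]; apply: w0. Qed.

Lemma kcoord_le w K i : all (fun a => a <= K)%N w -> (kcoord w i <= K)%N.
Proof.
move=> /all_nthP wK; case: i => [//|i]; rewrite /kcoord /=.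
by case: (ltnP i (size w)) => iw; [apply: wK|rewrite nth_default].
Qed.

Lemma kunz_direct3 w : all_pos w -> all (fun a => a <= 3)%N w ->
  kunz w <-> direct w.
Proof.
move=> w0 w3; split; first exact: kunz_direct.
move=> dw i j iw jw; case: (ltnP (size w) (i + j)) => ij; last first.
  by rewrite modn_small // addn0; apply: dw.
have := kcoord_le ((i + j) %% (size w).+1) w3.
have := @kcoord_gt0 w i w0; have := @kcoord_gt0 w j w0; lia.
Qed.

(** Two positive letters have sum at least 2, so a new last letter 1 or 2 satisfies
    every inequality. *)
Lemma direct_rcons w c : all_pos w -> (c <= 2)%N ->
  direct (rcons w c) <-> direct w.
Proof.
move=> w0 c2; split=> dw i j ij.
  have := dw i j; rewrite size_rcons => /(_ (leqW ij)).
  by rewrite !kcoord_rcons //; apply: leq_trans ij; rewrite ?leq_addr ?leq_addl.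
move: ij; rewrite size_rcons leq_eqVlt => /predU1P[ij|]; last first.
  rewrite ltnS => ij; rewrite !kcoord_rcons ?dw //;
    by apply: leq_trans ij; rewrite ?leq_addr ?leq_addl.
case: i ij => [|i] ij; first by rewrite add0n /kcoord /= leq_addl.
case: j ij => [|j] ij; first by rewrite addn0 leq_addr.
rewrite ij kcoord_rcons_last !kcoord_rcons; try lia.
have := @kcoord_gt0 w i.+1 w0; have := @kcoord_gt0 w j.+1 w0; lia.
Qed.

Lemma sum_kcoord w : (\sum_(v < (size w).+1) kcoord w v = sumn w)%N.
Proof. by rewrite big_ord_recl /= add0n -sumn_nth. Qed.

Lemma kunz_refl w (t v : 'I_(size w).+1) : kunz w ->
  (kcoord w t <= kcoord w v + kcoord w (t - v)%R + (t < v))%N.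
Proof.
move=> kw; have := kw v (t - v)%R (leq_ord _) (leq_ord _).
rewrite val_refl; have := ltn_ord t; have := ltn_ord v.
case: (ltnP t v) => tv vm tm.
  rewrite subnKC; last by lia.
  rewrite modnDr modn_small //; set x := kcoord w (_ - _); lia.
by rewrite subnKC // modn_small // (ltnNge (size w)) leq_ord.
Qed.

(** Reflecting at a letter at least 15 makes the sum of any two paired coordinates
    at least 14, so the mean coordinate is at least 7. *)
Lemma kunz_long w : kunz w -> has (fun a => 15 <= a)%N w -> (7 * (size w).+1 <= sumn w)%N.
Proof.
move=> kw /(has_nthP 0%N)[i iw wi].
pose t : 'I_(size w).+1 := Ordinal (iw : i.+1 < (size w).+1)%N.
have : (\sum_(v < (size w).+1) 14 <= \sum_(v < (size w).+1) (kcoord w v + kcoord w (t - v)%R))%N.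
  apply: leq_sum => v _; have := kunz_refl t v kw.
  have : (15 <= kcoord w t)%N by [].
  by case: (t < v)%N; lia.
have e : (\sum_(v < (size w).+1) kcoord w (t - v)%R = \sum_(v < (size w).+1) kcoord w v)%N.
  by rewrite [RHS](reindex_inj (inv_inj (@refl_involutive _ t))).
rewrite big_split /= [X in (_ + X)%N]e sum_kcoord sum_nat_const card_ord; lia.
Qed.

Section CyclicWord.
Variable w : seq nat.
Hypothesis w0 : all_pos w.
Hypothesis w14 : all (fun a => a <= 14)%N w.
Let f := word_ffun 14 (size w).+1 (3 :: w)%N.

Lemma cyc3E v : f v = nth 0%N (3 :: w)%N v :> nat.
Proof. by rewrite /f word_ffunE. Qed.

Lemma cyc_kcoord (v : 'I_(size w).+1) : (kcoord w v <= f v)%N.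
Proof. by rewrite cyc3E; case: v => -[|i] /=. Qed.

Lemma cyc_eq (v : 'I_(size w).+1) : (0 < v)%N -> f v = kcoord w v :> nat.
Proof. by rewrite cyc3E; case: v => -[|i] /=. Qed.

Lemma cyc_gt0 v : (0 < f v)%N.
Proof.
case: (posnP v) => [v0|v0]; first by rewrite cyc3E v0.
by rewrite cyc_eq // kcoord_gt0 // v0 -ltnS ltn_ord.
Qed.

Lemma kunz_refl_ge (t : 'I_(size w).+1) : kunz w -> (0 < t)%N -> refl_ge (f t) f t.
Proof.
move=> kw t0 v; rewrite [X in (X <= _)%N]cyc_eq //; apply: leq_trans (kunz_refl t v kw) _.
by rewrite leq_add2r leq_add // cyc_kcoord.
Qed.

(** Consider the largest frequent letter. If it is at most 3, or if there is none,
    the reflection at any letter at least 4 provides the sums at least 3. *)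
Lemma kunz_high_or_low k : kunz w -> has (fun a => 4 <= a)%N w -> (0 < k)%N ->
  high_word k f \/ low_word k f.
Proof.
move=> kw w4 k0.
pose often (p : 'I_15) := (4 <= p)%N && (k * k <= #|[set v | f v == p]%SET|)%N.
have pos_gt0 v : (4 <= f v)%N -> (0 < v)%N.
  by case: (posnP v) => // v0; rewrite cyc3E v0.
have [p0 op0|noften] := pickP often.
  left; case: (@arg_maxnP _ p0 often (fun p => p : nat) op0) => p /andP[p4 pk] pmax.
  exists p; split=> //; first exact: cyc_gt0.
    apply: count_above => q pq; rewrite ltnNge; apply/negP => qk.
    have oq : often q by rewrite /often qk andbT; apply: leq_trans (ltnW pq).
    by have := pmax q oq; rewrite /geq /= leqNgt pq.
  move=> t ft; rewrite -ft; apply: kunz_refl_ge => //.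
  by apply: pos_gt0; rewrite ft.
right; split; first exact: cyc_gt0.
- apply: count_above => q q3; rewrite ltnNge; apply/negP => qk.
  by have := noften q; rewrite /often q3 qk.
- have /(has_nthP 0%N)[i iw wi] := w4.
  pose t : 'I_(size w).+1 := Ordinal (iw : i.+1 < (size w).+1)%N.
  exists t => v; have := kunz_refl_ge (t := t) kw isT v.
  have : (4 <= f t)%N by rewrite cyc_eq.
  by case: (t < v)%N; lia.
- move=> t ft; case: (posnP t) => [t0|t0]; last first.
    by move=> v; rewrite -[X in (X <= _)%N]ft; apply: kunz_refl_ge.
  move=> v; case: (posnP v) => [v0|v0].
    have -> : f v = 3%N :> nat by rewrite cyc3E v0.
    by rewrite -addnA leq_addr.
  have := cyc_gt0 v; have := cyc_gt0 (t - v)%R; rewrite t0 v0; lia.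
Qed.

(** The last letter 3 provides the reflection [v |-> - v] with sums at least 3. *)
Lemma direct_low k : direct (rcons w 3) -> all (fun a => a <= 3)%N w -> (0 < k)%N ->
  low_word k f.
Proof.
move=> dw w3 k0; split; first exact: cyc_gt0.
- rewrite (_ : finset _ = set0) ?cards0 //; apply/setP => v; rewrite !inE ltnNge.
  case: (posnP v) => [v0|v0]; first by rewrite cyc3E v0.
  by rewrite cyc_eq // kcoord_le.
- exists ord0 => v; case: (posnP v) => [v0|v0].
    have -> : f v = 3%N :> nat by rewrite cyc3E v0.
    by rewrite leq_addr.
  have := dw v (0 - v)%R; rewrite val_refl v0 add0n size_rcons.
  have vm := ltn_ord v; rewrite subnKC; last by lia.
  rewrite leqnn => /(_ isT); rewrite kcoord_rcons_last !kcoord_rcons; try lia.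
  have e : f (0 - v)%R = kcoord w ((size w).+1 - v) :> nat.
    by rewrite cyc_eq val_refl v0 add0n //; lia.
  by rewrite e cyc_eq.
- move=> t ft v; have f0v := cyc_gt0 v; have f0tv := cyc_gt0 (t - v)%R.
  case: (ltnP t v) => tv; first by lia.
  case: (posnP v) => [v0|v0].
    have -> : f v = 3%N :> nat by rewrite cyc3E v0.
    by rewrite -addnA leq_addr.
  case: (ltngtP v t) (tv) => // [vt|vt] _; last first.
    have -> : f (t - v)%R = 3%N :> nat.
      by rewrite cyc3E val_refl (ltnNge t) tv /= vt subnn.
    by rewrite addn0 leq_addl.
  have := dw v (t - v)%N; rewrite subnKC // size_rcons.
  have := ltn_ord t => tm /(_ (ltnW tm)); rewrite !kcoord_rcons; try lia.
  have e : f (t - v)%R = kcoord w (t - v)%N :> nat.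
    by rewrite cyc_eq val_refl (ltnNge t) tv //= subn_gt0.
  rewrite e (cyc_eq v0) -(cyc_eq (v := t)) ?ft ?addn0 //.
  exact: leq_trans vt.
Qed.
End CyclicWord.

(** * Kunz words and numerical semigroups *)

Import classical_sets.
Local Open Scope classical_set_scope.

Lemma card_set_enum (T : choiceType) (A : set T) (s : seq T) : uniq s ->
  (forall x, A x <-> x \in s) -> card_set A = size s.
Proof.
move=> us As; rewrite /card_set.
have -> : A = [set` s] by apply/seteqP; split=> x /=; apply As.
have -> : fset_set [set` s] = seq_fset tt s.
  apply/fsetP => x; rewrite seq_fsetE in_fset_set; last exact: finite_seq.
  by apply/idP/idP => [/set_mem //|xs]; apply/mem_set.
by rewrite size_seq_fset undup_id.
Qed.

Lemma nat_minP (A : set nat) a : A a -> is_least A (nat_min A).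
Proof.
move=> Aa; rewrite /nat_min; case: xgetP => // none.
have ex : exists n, `[< A n >] by exists a; apply/asboolP.
case: (find_ex_minn ex) => m /asboolP Am mmin.
by case: (none m); split=> // b Ab; apply: mmin; apply/asboolP.
Qed.

Lemma nat_min_eq (A : set nat) a : A a -> (forall b, A b -> (a <= b)%N) -> nat_min A = a.
Proof.
move=> Aa amin; have [Am mmin] := nat_minP Aa.
by apply/eqP; rewrite eqn_leq mmin // amin.
Qed.

(** The inverse of taking Kunz coordinates: [kcoord w i * m + i], with
    [m = size w + 1], is the least element congruent to [i] modulo [m]. *)
Definition sgroup (w : seq nat) : set nat :=
  [set a | (kcoord w (a %% (size w).+1) <= a %/ (size w).+1)%N].

Definition gaps (w : seq nat) : seq nat :=
  [seq (i + k * (size w).+1)%N | i <- iota 0 (size w).+1, k <- iota 0 (kcoord w i)].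

Lemma mem_gaps w a : (a \in gaps w) = (a %/ (size w).+1 < kcoord w (a %% (size w).+1))%N.
Proof.
apply/allpairsPdep/idP => [[i [k []]]|aw].
  rewrite !mem_iota !add0n => /andP[_ im] /andP[_ kw] ->.
  by rewrite addnC divnMDl // divn_small // addn0 modnMDl modn_small.
exists (a %% (size w).+1)%N, (a %/ (size w).+1)%N.
by rewrite !mem_iota /= !add0n ltn_mod addnC -divn_eq.
Qed.

Lemma uniq_gaps w : uniq (gaps w).
Proof.
apply: allpairs_uniq_dep => [|i _|]; rewrite ?iota_uniq //.
move=> [i k] [i' k'] /allpairsPdep[j [l [jm _ [-> ->]]]].
move=> /allpairsPdep[j' [l' [jm' _ [-> ->]]]] /= e.
move: jm jm'; rewrite !mem_iota !add0n => /andP[_ jm] /andP[_ jm'].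
have ej : j = j'.
  have := congr1 (modn^~ (size w).+1) e.
  by rewrite /= ![(_ + _ * _)%N]addnC !modnMDl !modn_small.
move: e; rewrite ej => /addnI/eqP; rewrite eqn_mul2r => /orP[//|/eqP -> //].
Qed.

Lemma size_gaps w : size (gaps w) = sumn w.
Proof.
rewrite size_allpairs_dep -(sum_kcoord w) sumnE big_map.
rewrite -[in RHS](big_mkord xpredT (kcoord w)) /index_iota subn0.
by apply: eq_bigr => i _; rewrite size_iota.
Qed.

Lemma sgroupC w : ~` sgroup w = [set` gaps w].
Proof.
apply/seteqP; split=> a; rewrite /= mem_gaps /sgroup /= ltnNge => /negP //.
Qed.

Lemma genus_sgroup w : genus (sgroup w) = sumn w.
Proof.
rewrite /genus sgroupC -size_gaps; apply: card_set_enum; first exact: uniq_gaps.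
by [].
Qed.

Lemma semigroup_sgroup w : kunz w -> numerical_semigroup (sgroup w).
Proof.
move=> kw; split; first by rewrite /sgroup /= mod0n div0n.
  move=> a b; rewrite /sgroup /= => aw bw.
  have le c : (c %% (size w).+1 <= size w)%N by rewrite -ltnS ltn_mod.
  rewrite divnD // -modnDm; apply: leq_trans (kw _ _ (le _) (le _)) _.
  by rewrite leq_add2r leq_add.
by rewrite sgroupC; exact: finite_seq.
Qed.

Lemma multiplicity_sgroup w : all_pos w ->
  multiplicity (sgroup w) = (size w).+1.
Proof.
move=> w0; apply: nat_min_eq; first by split=> //; rewrite /sgroup /= modnn divnn.
move=> b [bw /eqP b0]; rewrite leqNgt; apply/negP => bm; move: bw.
rewrite /sgroup /= modn_small // divn_small // leqNgt kcoord_gt0 //.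
by rewrite lt0n b0.
Qed.

Lemma kcoord_sgroup w i k : (i <= size w)%N ->
  sgroup w (i + k * (size w).+1)%N <-> (kcoord w i <= k)%N.
Proof.
move=> iw; rewrite /sgroup /= addnC modnMDl modn_small ?ltnS //.
by rewrite divnMDl // divn_small ?ltnS // addn0.
Qed.

Lemma sgroup_inj w w' : all_pos w -> all_pos w' ->
  sgroup w = sgroup w' -> w = w'.
Proof.
move=> w0 w0' e.
have es : size w = size w'.
  by have := congr1 multiplicity e; rewrite !multiplicity_sgroup // => -[].
apply: (@eq_from_nth _ 0%N) => // i iw.
have h k : (kcoord w i.+1 <= k)%N <-> (kcoord w' i.+1 <= k)%N.
  by rewrite -!kcoord_sgroup -?es // e.
have := h (kcoord w i.+1); have := h (kcoord w' i.+1); rewrite !leqnn /kcoord /=.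
move=> [_ /(_ isT) h1] [/(_ isT) h2 _]; apply/eqP; rewrite eqn_leq.
by rewrite h1 h2.
Qed.

(** The depth is at most 3 exactly when [3 m] is at least the conductor, that is
    when all numbers from [3 m] on belong to the semigroup, [m] being the
    multiplicity. *)
Lemma depth_sgroup w : all_pos w ->
  (depth (sgroup w) <= 3) = all (fun a => a <= 3)%N w.
Proof.
move=> w0; rewrite /depth multiplicity_sgroup // /conductor.
set C := [set c | _]; set m := (size w).+1.
have Cup a b : C a -> (a <= b)%N -> C b.
  by move=> Ca ab k; rewrite -(subnKC ab) -addnA; apply: Ca.
have C3 K : C (K * m)%N <-> all (fun a => a <= K)%N w.
  split=> [CK|wK k]; last first.
    by rewrite /sgroup /= divnMDl //; apply: leq_trans (kcoord_le _ wK) (leq_addr _ _).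
  apply/(all_nthP 0%N) => i iw; have := CK i.+1; rewrite addnC.
  by rewrite kcoord_sgroup.
have Cne : C (sumn w * m)%N.
  by apply/C3/allP => a aw; rewrite sumnE (big_rem a) //= leq_addr.
have [Cc cmin] := nat_minP Cne.
rewrite ceil_le_int ler_pdivrMr ?ltr0n // (_ : 3%:~R = 3%:R) // -natrM ler_nat.
apply/idP/idP => [c3|/C3]; last exact: cmin.
by apply/C3/(Cup _ _ Cc).
Qed.

(** The coordinate of [i] is the number of steps of size [m], the multiplicity,
    that lead from [i] into the semigroup; minimality of [m] makes it positive
    for [0 < i < m]. *)
Lemma semigroup_kunz (L : set nat) : numerical_semigroup L ->
  exists w, [/\ kunz w, all_pos w & L = sgroup w].
Proof.
move=> [L0 LD Lcof].
have [N LN] : exists N, forall a, (N <= a)%N -> L a.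
  exists (\max_(a <- fset_set (~` L)) a).+1 => a Na; apply: contrapT => nLa.
  have aL : a \in fset_set (~` L) by rewrite in_fset_set //; apply/mem_set.
  by move: Na; rewrite ltnNge (leq_bigmax_seq (F := id)).
have Lne : (L `\ 0%N) N.+1 by split=> //; apply: LN.
have [[Lm /eqP m0] mmin] := nat_minP Lne.
have {}m0 : (0 < nat_min (L `\ 0%N))%N by rewrite lt0n.
move: Lm mmin; set m := nat_min _ in m0 *; case: m m0 => // n _ Lm mmin.
have Lmul a k : L a -> L (a + k * n.+1)%N.
  move=> La; elim: k => [|k IH]; first by rewrite addn0.
  by rewrite mulSn addnCA; apply: LD.
pose x i := nat_min [set k | L (i + k * n.+1)%N].
have xP i : is_least [set k | L (i + k * n.+1)%N] (x i).
  apply: (@nat_minP _ N); apply: LN; rewrite mulnS addnA -addnA addnCA.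
  by apply: leq_addr.
have xL i k : L (i + k * n.+1)%N <-> (x i <= k)%N.
  split=> [|xk]; first by apply: (xP i).2.
  by have := Lmul _ (k - x i)%N (xP i).1; rewrite -addnA -mulnDl subnKC.
have x0 : x 0%N = 0%N by apply/eqP; rewrite -leqn0; apply/xL.
pose w := [seq x i.+1 | i <- iota 0 n].
have wn : size w = n by rewrite size_map size_iota.
have wx i : (i <= n)%N -> kcoord w i = x i.
  case: i => [|i] i_n; first by rewrite /kcoord /= x0.
  by rewrite /kcoord /= (nth_map 0%N) ?size_iota // nth_iota.
have le a : (a %% n.+1 <= n)%N by rewrite -ltnS ltn_mod.
have Lw : L = sgroup w.
  apply/seteqP; split=> a; rewrite /sgroup /= wn wx ?le // => La.
    by apply/xL; rewrite addnC -divn_eq.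
  by move/xL: La; rewrite addnC -divn_eq.
exists w; split=> //.
  move=> i j; rewrite wn => i_n j_n; rewrite !wx ?le //; apply/xL.
  have Lij : L ((i + j) + (x i + x j) * n.+1)%N.
    by rewrite mulnDl addnACA; apply: LD; [exact: (xP i).1|exact: (xP j).1].
  have [ij|ij] := ltnP n (i + j); last by rewrite modn_small // addn0.
  rewrite -[X in (X %% _)%N](subnK ij) modnDr modn_small; last by lia.
  by rewrite addn1 mulSn addnA subnK.
apply/allP => a /mapP[i]; rewrite mem_iota add0n => /andP[_ i_n] ->.
rewrite lt0n; apply/eqP => xi.
have : L (i.+1 + 0 * n.+1)%N by apply/xL; rewrite xi.
rewrite addn0 => Li; have : (n.+1 <= i.+1)%N by apply: mmin.
lia.
Qed.

Lemma size_le_sumn w : all_pos w -> (size w <= sumn w)%N.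
Proof. by elim: w => //= a w IH /andP[a0 /IH h]; rewrite -add1n leq_add. Qed.

Definition enumerates_comps (g : nat) (s : seq (seq nat)) : Prop :=
  uniq s /\ forall w, (w \in s) = all_pos w && (sumn w == g).

(** All letters and the length are at most [g], which embeds the words in a finite
    type. *)
Lemma compositions_finite (g : nat) : exists s, enumerates_comps g s.
Proof.
pose all_words := [seq map (@nat_of_ord g.+1) (val b) | b <- enum {: {bseq g of 'I_g.+1}}].
exists [seq w <- all_words | all_pos w && (sumn w == g)].
split.
  rewrite filter_uniq // map_inj_uniq ?enum_uniq // => b b' e.
  by apply/val_inj; apply: inj_map e; apply: val_inj.
move=> w; rewrite mem_filter; apply: andb_idr => /andP[w0 /eqP wg].
have wK a : a \in w -> (a <= g)%N by move=> aw; rewrite -wg sumnE (big_rem a) //= leq_addr.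
have ws : (size w <= g)%N by rewrite -wg size_le_sumn.
have bs : (size (map (@inord g) w) <= g)%N by rewrite size_map.
apply/mapP; exists (Bseq bs); first by rewrite mem_enum.
rewrite /= -map_comp -[LHS]map_id; apply/eq_in_map => a aw /=.
by rewrite inordK // ltnS wK.
Qed.

Lemma card_semigroups (g : nat) (s : seq (seq nat)) (P : set (set nat)) (Q : pred (seq nat)) :
  enumerates_comps g s -> (forall w, all_pos w -> P (sgroup w) <-> Q w) ->
  card_set [set L | [/\ numerical_semigroup L, genus L = g & P L]] =
  count (fun w => `[< kunz w >] && Q w) s.
Proof.
move=> [us sP] PQ; rewrite -size_filter.
rewrite -(size_map sgroup); apply: card_set_enum.
  rewrite map_inj_in_uniq ?filter_uniq // => w w'.
  rewrite !mem_filter !sP => /and3P[_ w0 _] /and3P[_ w0' _]; exact: sgroup_inj.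
move=> L; split=> [[sL gL PL]|/mapP[w]].
  have [w [kw w0 Lw]] := semigroup_kunz sL; apply/mapP; exists w => //.
  rewrite mem_filter sP w0 -gL Lw genus_sgroup eqxx !andbT.
  by apply/andP; split; [apply/asboolP|apply/(PQ w w0); rewrite -Lw].
rewrite mem_filter sP => /and3P[/andP[/asboolP kw Qw] w0 /eqP wg] ->; split.
- exact: semigroup_sgroup.
- by rewrite genus_sgroup.
- exact/(PQ w w0).
Qed.

Lemma n_count g (s : seq (seq nat)) : enumerates_comps g s ->
  n_ g = count (fun w => `[< kunz w >]) s.
Proof.
move=> sP; rewrite (eq_count (a2 := fun w => `[< kunz w >] && xpredT w)); last first.
  by move=> w; rewrite andbT.
rewrite -(card_semigroups (P := setT) sP) //; congr card_set.
by apply/seteqP; split=> L //= [].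
Qed.

Lemma t_count g (s : seq (seq nat)) : enumerates_comps g s ->
  t_ g = count (fun w => `[< kunz w >] && all (fun a => a <= 3)%N w) s.
Proof.
move=> sP; rewrite -(card_semigroups (P := [set L | depth L <= 3]) sP) //.
by move=> w w0 /=; rewrite depth_sgroup.
Qed.

(** * The Fibonacci recurrence up to depth three *)

Lemma shallowE w : all_pos w ->
  `[< kunz w >] && all (fun a => a <= 3)%N w = all (fun a => a <= 3)%N w && `[< direct w >].
Proof.
move=> w0; rewrite andbC; case w3 : (all _ w) => //=.
by apply/asboolP/asboolP => /(kunz_direct3 w0 w3).
Qed.

Lemma mem_map_rcons (F : seq (seq nat)) w (c d : nat) :
  (rcons w c \in [seq rcons u d | u <- F]) = (c == d) && (w \in F).
Proof.
apply/mapP/andP => [[u uF /rcons_inj[-> ->]]|[/eqP -> wF]]; first by rewrite eqxx.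
by exists w.
Qed.

Lemma uniq_map_rcons (F : seq (seq nat)) (d : nat) :
  uniq F -> uniq [seq rcons u d | u <- F].
Proof. by move=> uF; rewrite map_inj_uniq // => u v /rcons_inj[]. Qed.

(** The words of depth at most 3 are sorted by their last letter; the letters 1
    and 2 can be appended freely by [direct_rcons]. *)
Lemma t_recurrence g s1 s2 s3 : (3 <= g)%N ->
  enumerates_comps (g - 1) s1 -> enumerates_comps (g - 2) s2 -> enumerates_comps (g - 3) s3 ->
  t_ g = (t_ (g - 1) + t_ (g - 2) +
          count (fun w => `[< direct (rcons w 3) >] && all (fun a => a <= 3)%N w) s3)%N.
Proof.
move=> g3 e1 e2 [u3 h3]; have [s es] := compositions_finite g.
rewrite (t_count es) (t_count e1) (t_count e2) -!size_filter.
move: es e1 e2 => [us sP] [u1 h1] [u2 h2].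
set E := [seq w <- s3 | _]; set F1 := [seq w <- s1 | _]; set F2 := [seq w <- s2 | _].
pose S := [seq rcons u 1 | u <- F1]%N ++ [seq rcons u 2 | u <- F2]%N ++ [seq rcons u 3 | u <- E]%N.
have -> : (size F1 + size F2 + size E = size S)%N by rewrite !size_cat !size_map addnA.
apply/perm_size/uniq_perm; first exact: filter_uniq.
  rewrite !cat_uniq !uniq_map_rcons ?filter_uniq //= andbT.
  apply/andP; split; apply/hasPn => w.
    rewrite mem_cat => /orP[] /mapP[u _ ->]; by rewrite /= mem_map_rcons.
  by move=> /mapP[u _ ->]; rewrite /= mem_map_rcons.
move=> w; rewrite mem_filter sP !mem_cat.
case: (lastP w) => [|{}w c].
  have nil d (F : seq (seq nat)) : ([::] \in [seq rcons u d | u <- F]) = false.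
    by apply/mapP => -[u _ /(congr1 size)]; rewrite size_rcons.
  by rewrite !nil /= andbC; case: eqP => // g0; rewrite -g0 in g3.
rewrite !mem_map_rcons !mem_filter h1 h2 h3 [all_pos (rcons w c)]all_rcons sumn_rcons.
have [w0|_] := boolP (all_pos w); last by rewrite /= !andbF /= ?andbF.
case: c => [|c]; first by rewrite /= ?andbF.
have r0 : all_pos (rcons w c.+1) by rewrite all_rcons.
rewrite (shallowE r0) (shallowE w0) all_rcons.
have eqg d : (d <= 3)%N -> (sumn w + d == g) = (sumn w == g - d)%N.
  by move=> d3; apply/eqP/eqP; lia.
have dE d : (d <= 2)%N -> `[< direct (rcons w d) >] = `[< direct w >].
  by move=> d2; apply/asboolP/asboolP => /(direct_rcons w0 d2).
case: c {r0} => [|[|[|c]]] //=.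
- by rewrite dE // eqg // orbF.
- by rewrite dE // eqg // orbF.
- by rewrite eqg // [in RHS]andbC [in LHS]andbC; congr (_ && _); rewrite andbC.
Qed.

Section Bounds.
Variable R : realType.
Local Notation rho := (rate R).

(** By [t_recurrence], [s_ g] counts the words of sum [g] whose last letter is 3;
    without that letter they are low words. *)
Lemma s_bound : exists2 C : R, 0 <= C &
  forall g, (3 <= g)%N -> 0 <= (s_ g)%:~R :> R /\ (s_ g)%:~R <= C * rho ^+ g.
Proof.
have [k [k0 [C C0 Cg]]] := tame_growth R.
exists C => // g g3.
have [s1 e1] := compositions_finite (g - 1).
have [s2 e2] := compositions_finite (g - 2).
have [s3 e3] := compositions_finite (g - 3); have [u3 h3] := e3.
rewrite /s_ (@t_recurrence g s1 s2 s3) //; rewrite -size_filter.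
set E := [seq w <- s3 | _].
rewrite (_ : _ - _ - _ = (size E)%:Z); last by rewrite !PoszD; ring.
rewrite -pmulrn; split; first exact: ler0n.
apply: le_trans (Cg (g - 3)%N E _ _) _.
- exact: filter_uniq.
- move=> w; rewrite mem_filter h3 => /andP[/andP[/asboolP dw w3] /andP[w0 /eqP wg]].
  have w14 : all (fun a => a <= 14)%N w by apply: sub_all w3 => a; lia.
  by split=> //; [rewrite -wg size_le_sumn|right; apply: direct_low].
- apply: ler_wpM2l => //; apply: ler_weXn2l; last exact: leq_subr.
  by rewrite /rho; lra.
Qed.

(** The difference counts the words with a letter at least 4; those with a letter
    at least 15 are short, the others are high or low words. *)
Lemma deep_bound : exists2 C : R, 0 <= C &
  forall g, (0 : R) <= (n_ g)%:R - (t_ g)%:R <= C * rho ^+ g.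
Proof.
have [k [k0 [C C0 Cg]]] := tame_growth R; have [D D0 Dg] := long_growth R.
exists (C + D); first exact: addr_ge0.
move=> g; have [s es] := compositions_finite g.
rewrite (n_count es) (t_count es); move: es => [us sP].
set P := (fun w => `[< kunz w >]); pose long : pred (seq nat) := has (fun a => 15 <= a)%N.
pose deep : pred (seq nat) := fun w => ~~ all (fun a => a <= 3)%N w.
have split_count (A B : pred (seq nat)) :
    count A s = (count (predI A (predC B)) s + count (predI A B) s)%N.
  by elim: {us sP}s => //= w s ->; case: (A w) (B w) => -[] /=; lia.
rewrite (split_count P deep) (split_count (predI P deep) long).
rewrite (eq_count (a1 := fun w => _ && _) (a2 := predI P (predC deep))); last first.
  by move=> w; rewrite /= negbK.
rewrite natrD [X in X - _]addrC addrK ler0n /= natrD mulrDl -!size_filter.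
apply: lerD; [apply: Cg|apply: Dg]; rewrite ?filter_uniq //.
- move=> w; rewrite mem_filter sP => /andP[/andP[/andP[/asboolP kw dw] lw] /andP[w0 /eqP wg]].
  have w14 : all (fun a => a <= 14)%N w.
    by move: lw; rewrite /= -all_predC; apply: sub_all => a /=; rewrite -leqNgt.
  split=> //; first by rewrite -wg size_le_sumn.
  apply: kunz_high_or_low => //.
  by move: dw; rewrite /deep -has_predC; apply: sub_has => a /=; rewrite -ltnNge.
- move=> w; rewrite mem_filter sP => /andP[/andP[/andP[/asboolP kw dw] lw] /andP[w0 /eqP wg]].
  by split=> //; rewrite -wg kunz_long.
Qed.
End Bounds.

(** * Solving the recurrence *)

Lemma direct_le2 w : all_pos w -> all (fun a => a <= 2)%N w -> direct w.
Proof.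
move=> w0 w2 i j ij; case: i ij => [|i] ij; first by rewrite add0n leq_addl.
case: j ij => [|j] ij; first by rewrite addn0 leq_addr.
have := kcoord_le (i.+1 + j.+1) w2.
have := @kcoord_gt0 w i.+1 w0; have := @kcoord_gt0 w j.+1 w0; lia.
Qed.

Lemma t_1 : t_ 1 = 1%N.
Proof.
rewrite (@t_count 1 [:: [:: 1%N]]) //=.
  have -> : `[< kunz [:: 1%N] >] by apply/asboolP/kunz_direct3 => //; apply: direct_le2.
  by [].
split=> // -[|[|[|a]] [|[|b] w]] //=; rewrite ?inE //=;
  by apply/esym/negP => /andP[_ /eqP]; lia.
Qed.

Lemma t_2 : t_ 2 = 2%N.
Proof.
rewrite (@t_count 2 [:: [:: 2%N]; [:: 1%N; 1%N]]) //=.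
  have -> : `[< kunz [:: 2%N] >] by apply/asboolP/kunz_direct3 => //; apply: direct_le2.
  have -> : `[< kunz [:: 1%N; 1%N] >] by apply/asboolP/kunz_direct3 => //; apply: direct_le2.
  by [].
split=> // -[|[|[|[|a]]] [|[|[|b]] [|[|c] w]]] //=; rewrite ?inE //=;
  by apply/esym/negP => /andP[_ /eqP]; lia.
Qed.

Section Final.
Variable R : realType.
Local Notation rho := (rate R).
Local Notation phi := (phi R).
Local Notation psi := (1 - phi).
Local Notation sqrt5 := (Num.sqrt 5 : R).
Local Notation psum := (@s_partial_sum R).

Lemma sqrt5_bounds : 22%:R / 10%:R < sqrt5 < 23%:R / 10%:R.
Proof.
have : sqrt5 ^+ 2 = 5 by rewrite sqr_sqrtr.
move: (Num.sqrt 5) (sqrtr_ge0 (5 : R)) => s s0 s5.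
by apply/andP; split; rewrite ltNge; apply/negP => h; nra.
Qed.

Lemma phi_sqr : phi ^+ 2 = phi + 1.
Proof.
have s5 : sqrt5 ^+ 2 = 5 by rewrite sqr_sqrtr.
rewrite /Defs.phi; move: s5; move: (Num.sqrt 5) => s s5; nra.
Qed.

Lemma phi_bounds : 16%:R / 10%:R < phi < 165%:R / 100%:R.
Proof. by have := sqrt5_bounds; rewrite /Defs.phi; move: (Num.sqrt 5) => s; lra. Qed.

Lemma phi_gt0 : 0 < phi. Proof. by have := phi_bounds; lra. Qed.

Lemma s_E g : (3 <= g)%N -> (s_ g)%:~R = (t_ g)%:R - (t_ (g - 1))%:R - (t_ (g - 2))%:R :> R.
Proof. by move=> g3; rewrite /s_ !rmorphB /= -!pmulrn. Qed.

(** The components of the sequence [t_] along the two solutions of the Fibonacci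
    recurrence: without the terms [s_], the first would be multiplied at each
    step by [phi], and the second by [1 - phi]. *)
Definition growing_part g : R := (t_ g)%:R - psi * (t_ (g - 1))%:R.
Definition decaying_part g : R := (t_ g)%:R - phi * (t_ (g - 1))%:R.

Lemma growing_part_psum g : (2 <= g)%N -> growing_part g = phi ^+ g * (1 + psum g.+1).
Proof.
move=> g2; have := phi_sqr; have := phi_gt0 => p0 p2; have pn0 := lt0r_neq0 p0.
elim: g g2 => // g IH; rewrite leq_eqVlt => /predU1P[<-|g2].
  rewrite /growing_part t_2 t_1 /s_partial_sum big_geq // addr0 mulr1 p2.
  by move: p2; move: phi => p; lra.
have g3 : (3 <= g.+1)%N by [].
have -> : psum g.+2 = psum g.+1 + (s_ g.+1)%:~R * phi ^- g.+1.
  by rewrite /s_partial_sum big_nat_recr.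
have -> (x y : R) : phi ^+ g.+1 * (1 + (x + y * phi ^- g.+1)) = phi * (phi ^+ g * (1 + x)) + y.
  rewrite exprS; have := expf_neq0 g pn0; move: (phi ^+ g) => q q0; field.
  by rewrite pn0 q0.
rewrite -IH // s_E // /growing_part !subSS subn0.
move: (phi) p2 => p p2.
move: ((t_ (g - 1))%:R) ((t_ g)%:R) ((t_ g.+1)%:R) => z y x.
apply/eqP; rewrite -subr_eq0; apply/eqP; transitivity ((p + 1 - p ^+ 2) * z); first by ring.
by rewrite p2 subrr mul0r.
Qed.

Variable C : R.
Hypothesis C0 : 0 <= C.
Hypothesis s_le : forall g, (3 <= g)%N -> 0 <= (s_ g)%:~R :> R /\ (s_ g)%:~R <= C * rho ^+ g.

Let q : R := rho / phi.

Lemma q_bounds : 0 < q < 97%:R / 100%:R.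
Proof.
have p0 := phi_gt0; have := phi_bounds => pb.
rewrite /q divr_gt0 //=; last by rewrite /rho; lra.
by rewrite ltr_pdivrMr // /rho; lra.
Qed.

Lemma q_pow N : q ^+ N * phi ^+ N = rho ^+ N.
Proof. by rewrite -exprMn /q divfK // gt_eqF // phi_gt0. Qed.

Lemma psum_step N : (3 <= N)%N -> 0 <= psum N.+1 - psum N <= C * q ^+ N.
Proof.
move=> N3; have p0 := phi_gt0.
have -> : psum N.+1 - psum N = (s_ N)%:~R * phi ^- N.
  by rewrite /s_partial_sum big_nat_recr //= addrAC subrr add0r.
have [s0 s1] := s_le N3.
have i0 : 0 <= phi ^- N by rewrite invr_ge0 exprn_ge0 // ltW.
apply/andP; split; first exact: mulr_ge0.
by rewrite ler_pdivrMr ?exprn_gt0 // -mulrA q_pow.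
Qed.

(** The constant 40 exceeds [1 / (1 - q)]. *)
Lemma psum_bounds N M : (3 <= N)%N -> (N <= M)%N ->
  psum N <= psum M <= psum N + C * 40%:R * q ^+ N.
Proof.
move=> N3 NM; have [q0 q1] := andP q_bounds.
suff : psum N <= psum M <= psum N + C * 40%:R * (q ^+ N - q ^+ M).
  move=> /andP[-> h] /=; apply: le_trans h _; rewrite lerD2l ler_wpM2l ?mulr_ge0 //.
  by rewrite gerBl exprn_ge0 // ltW.
rewrite -(subnKC NM); elim: (M - N)%N => [|k /andP[h1 h2]].
  by rewrite addn0 lexx subrr mulr0 addr0 /=.
have /andP[h3 h4] := psum_step (leq_trans N3 (leq_addr k N)).
rewrite addnS exprS; have := exprn_ge0 (N + k) (ltW q0).
move: (q ^+ (N + k)) h2 h4 => x h2 h4 x0.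
have : C * x <= C * 40%:R * (x - q * x).
  have : 0 <= C * x by apply: mulr_ge0.
  have -> : C * 40%:R * (x - q * x) = (C * x) * (40%:R * (1 - q)) by ring.
  move: (C * x) => y y0; nra.
move: h1 h2 h3 h4.
have -> : C * 40%:R * (q ^+ N - q * x) = C * 40%:R * (q ^+ N - x) + C * 40%:R * (x - q * x) by ring.
lra.
Qed.

Lemma psum_nondecreasing : nondecreasing_seq psum.
Proof.
apply/nondecreasing_seqP => n; case: (leqP 3 n) => n3.
  by case/andP: (psum_bounds n3 (leqnSn n)).
by rewrite /s_partial_sum !big_geq // ltnW.
Qed.

Lemma psum_cvg : cvgn psum.
Proof.
apply: nondecreasing_is_cvgn; first exact: psum_nondecreasing.
exists (psum 3 + C * 40%:R * q ^+ 3) => _ [n _ <-].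
case: (leqP 3 n) => n3; first by case/andP: (psum_bounds (leqnn 3) n3).
apply: le_trans (psum_nondecreasing (ltnW n3)) _.
by case/andP: (psum_bounds (leqnn 3) (leqnn 3)).
Qed.

Lemma psum_lim N : (3 <= N)%N -> psum N <= limn psum <= psum N + C * 40%:R * q ^+ N.
Proof.
move=> N3; rewrite (nondecreasing_cvgn_le psum_nondecreasing psum_cvg) /=.
apply: limr_le; first exact: psum_cvg.
near=> n; have Nn : (N <= n)%N by near: n; exact: nbhs_infty_ge.
by case/andP: (psum_bounds N3 Nn).
Unshelve. all: by end_near.
Qed.

Lemma growing_part_le g : (2 <= g)%N ->
  `|growing_part g - (1 + limn psum) * phi ^+ g| <= C * 40%:R * rho ^+ g.
Proof.
move=> g2; rewrite growing_part_psum // mulrC -mulrBl.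
have [q0 q1] := andP q_bounds; have p0 := phi_gt0.
have /andP[h1 h2] := @psum_lim g.+1 g2.
rewrite normrM (ger0_norm (exprn_ge0 _ (ltW p0))).
have -> : C * 40%:R * rho ^+ g = C * 40%:R * q ^+ g * phi ^+ g.
  by rewrite -[RHS]mulrA q_pow.
apply: ler_wpM2r; first by rewrite exprn_ge0 // ltW.
have h : C * 40%:R * q ^+ g.+1 <= C * 40%:R * q ^+ g.
  rewrite ler_wpM2l ?mulr_ge0 // exprS ler_piMl ?exprn_ge0 ?(ltW q0) //; lra.
rewrite ler_norml; move: h1 h2 h; move: (limn psum) (psum g.+1) => l p.
move: (C * 40%:R * _) (C * 40%:R * _) => x y; lra.
Qed.

Lemma decaying_part_le : exists2 K : R, 0 <= K &
  forall g, (2 <= g)%N -> `|decaying_part g| <= K * rho ^+ g.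
Proof.
pose K := 2%:R * C + `|decaying_part 2|.
have K0 : 0 <= K by rewrite addr_ge0 ?mulr_ge0.
have rho1 : 1 <= rho by rewrite /rho; lra.
exists K => // g; elim: g => // g IH; rewrite leq_eqVlt => /predU1P[<-|g2].
  apply: (@le_trans _ _ (K * 1)); first by rewrite mulr1 /K lerDr mulr_ge0.
  by rewrite ler_wpM2l // exprn_ege1.
have -> : decaying_part g.+1 = psi * decaying_part g + (s_ g.+1)%:~R.
  rewrite s_E // /decaying_part !subSS subn0.
  have := phi_sqr; move: (phi) => p p2.
  move: ((t_ (g - 1))%:R) ((t_ g)%:R) ((t_ g.+1)%:R) => z y x.
  apply/eqP; rewrite -subr_eq0; apply/eqP; transitivity ((p + 1 - p ^+ 2) * z); first by ring.
  by rewrite p2 subrr mul0r.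
have [s0 s1] := @s_le g.+1 g2.
apply: le_trans (ler_normD _ _) _; rewrite normrM (ger0_norm s0).
have psi1 : `|psi| <= 7%:R / 10%:R.
  by have := phi_bounds; rewrite ler_norml; move: (phi) => p; lra.
have := ler_pM (normr_ge0 _) (normr_ge0 _) psi1 (IH g2).
move: s1; rewrite exprS; have : 0 <= rho ^+ g by rewrite exprn_ge0 // (le_trans ler01).
move: (rho ^+ g) => x x0; rewrite /rho.
have : C <= K / 2%:R by rewrite /K; have := normr_ge0 (decaying_part 2); lra.
move: (`|psi| * _) ((s_ g.+1)%:~R) => a b CK s1 h.
have : C * x <= K / 2%:R * x by apply: ler_wpM2r.
have : 0 <= K * x by apply: mulr_ge0.
move: s1 h; nra.
Qed.
End Final.

(** * The error term *)

(** [Num.sqrt 5 * t_ g] is the combination of the growing part and the decaying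
    part with coefficients [phi] and [phi - 1], and [S_const * phi ^+ g] is the
    limiting value of the first term. *)
Lemma error_le (R : realType) : cvgn (@s_partial_sum R) /\ exists2 C : R, 0 <= C &
  forall g, (2 <= g)%N -> `|(n_ g)%:R - S_const R * phi R ^+ g| <= C * rate R ^+ g.
Proof.
have [C C0 sC] := s_bound R; have [D D0 deepD] := deep_bound R.
split; first exact: psum_cvg C0 sC.
have [K K0 dK] := decaying_part_le C0 sC.
exists (D + C * 40%:R + K); first by rewrite !addr_ge0 ?mulr_ge0.
move=> g g2; have pb := phi_bounds R; have sb := sqrt5_bounds R.
have s0 : Num.sqrt 5 != 0 :> R by apply/eqP; lra.
pose A := growing_part R g - (1 + limn (@s_partial_sum R)) * phi R ^+ g.
have -> : (n_ g)%:R - S_const R * phi R ^+ g = ((n_ g)%:R - (t_ g)%:R) +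
    (phi R / Num.sqrt 5 * A - (1 - phi R) / Num.sqrt 5 * decaying_part R g).
  have sE : Num.sqrt 5 = 2 * phi R - 1 :> R by rewrite /Defs.phi; field.
  rewrite /A /S_const /growing_part /decaying_part.
  move: (limn _) (phi R ^+ g) => l pg; rewrite sE; field.
  by rewrite -sE.
have hA := growing_part_le C0 sC g2; have hD := deepD g; have hK := dK g g2.
rewrite (_ : (D + C * 40%:R + K) * rate R ^+ g =
  D * rate R ^+ g + (C * 40%:R * rate R ^+ g + K * rate R ^+ g)); last by ring.
apply: le_trans (ler_normD _ _) _; apply: lerD.
  by case/andP: hD => h1 h2; rewrite ger0_norm.
apply: le_trans (ler_normB _ _) _; apply: lerD.
  rewrite normrM; apply: le_trans hA; rewrite ler_piMl //.
  by rewrite ger0_norm ?divr_ge0 ?ler_pdivrMr; lra.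
rewrite normrM; apply: le_trans hK; rewrite ler_piMl //.
by rewrite ler_norml ler_pdivrMr ?ler_pdivlMr; lra.
Qed.

(** On the positive axis the polynomial increases, and its value at the inverse of
    [rate] is positive; its positive root is therefore smaller. *)
Lemma r154_gt (R : realType) : rate R < r154 R.
Proof.
have pE (x : R) : (r154_poly R).[x] =
    x ^+ 4 * (x + 1) ^+ 2 * (x ^+ 4 + 2 * x ^+ 3 + x ^+ 2 + 1) - 1.
  by rewrite /r154_poly !hornerE.
have [x0 x01 rx0] : exists2 x : R, 1 / 2%:R <= x <= 1 & root (r154_poly R) x.
  by apply: poly_ivt; [lra|rewrite !pE; apply/andP; split; lra].
have x0P : [set x : R | 0 < x /\ root (r154_poly R) x] x0.
  by split=> //; lra.
rewrite /r154; case: xgetP => [x _ [xgt0 rx]|/(_ _ x0P) //].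
have r0 : 0 < rate R by rewrite /rate; lra.
rewrite -[rate R]invrK ltf_pV2 ?posrE ?invr_gt0 // ltNge; apply/negP => ax.
move: rx; rewrite rootE pE subr_eq0 => /eqP px.
pose a := (rate R)^-1; have a0 : 0 < a by rewrite invr_gt0.
have mono (u v : R) n : 0 <= u -> u <= v -> u ^+ n <= v ^+ n.
  by move=> u0 uv; apply: lerXn2r; rewrite ?nnegrE // (le_trans u0).
have : a ^+ 4 * (a + 1) ^+ 2 * (a ^+ 4 + 2 * a ^+ 3 + a ^+ 2 + 1) <= 1.
  have a0' := ltW a0; have b0 : 0 <= a + 1 by lra.
  have x0' : 0 <= x := ltW xgt0; have axl : a <= x by [].
  have h1 : a ^+ 4 * (a + 1) ^+ 2 <= x ^+ 4 * (x + 1) ^+ 2.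
    by apply: ler_pM; rewrite ?exprn_ge0 ?mono // lerD2r.
  have h2 : a ^+ 4 + 2 * a ^+ 3 + a ^+ 2 + 1 <= x ^+ 4 + 2 * x ^+ 3 + x ^+ 2 + 1.
    by rewrite !lerD ?ler_wpM2l ?mono.
  have n1 : 0 <= a ^+ 4 * (a + 1) ^+ 2 by apply: mulr_ge0; exact: exprn_ge0.
  have n2 : 0 <= a ^+ 4 + 2 * a ^+ 3 + a ^+ 2 + 1.
    have := exprn_ge0 4 a0'; have := exprn_ge0 3 a0'; have := exprn_ge0 2 a0'; lra.
  by apply: le_trans (ler_pM n1 n2 h1 h2) _; rewrite px.
rewrite /a /rate invf_div => h; lra.
Qed.

(** The constant [C] is absorbed by the powers of [r / q] from some rank on. *)
Lemma limn_esup_powR_le (R : realType) (X : nat -> R) (C q r : R) : 0 < q -> q < r -> 0 <= C ->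
  (forall g, (2 <= g)%N -> 0 <= X g <= C * q ^+ g) ->
  (limn_esup (fun g => (X g `^ (g%:R^-1))%:E) <= r%:E)%E.
Proof.
move=> q0 qr C0 XC; pose h := r / q - 1.
have h0 : 0 < h by rewrite /h subr_gt0 ltr_pdivlMr // mul1r.
pose N := (Num.bound (C / h)).+2.
have r0 : 0 < r by apply: lt_trans qr.
rewrite /limn_esup limf_esupE; apply: ge_ereal_inf.
exists (ereal_sup ((fun g => (X g `^ (g%:R^-1))%:E) @` [set g | (N <= g)%N])).
  by exists [set g | (N <= g)%N] => //; exact: nbhs_infty_ge.
apply: ge_ereal_sup => _ [g Ng <-]; rewrite lee_fin.
have g2 : (2 <= g)%N by apply: leq_trans Ng.
have /andP[X0 Xq] := XC g g2.
have gn0 : g%:R != 0 :> R by rewrite pnatr_eq0 -lt0n ltnW.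
have -> : r = (r ^+ g) `^ (g%:R^-1).
  by rewrite -powR_mulrn ?(ltW r0) // -powRrM mulfV // powRr1 // ltW.
apply: ge0_ler_powR; rewrite ?invr_ge0 ?nnegrE ?exprn_ge0 ?(ltW r0) //.
apply: le_trans Xq _; have -> : r ^+ g = (1 + h) ^+ g * q ^+ g.
  by rewrite -exprMn /h addrCA subrr addr0 divfK // gt_eqF.
apply: ler_wpM2r; first by rewrite exprn_ge0 // ltW.
apply: le_trans (bernoulli_ineq g (ltW h0)).
have hC : C / h <= g%:R.
  apply: ltW; apply: lt_le_trans (archi_boundP _) _; first by rewrite divr_ge0 // ltW.
  by rewrite ler_nat (leq_trans _ Ng) // /N leqW // leqW.
apply: (@le_trans _ _ (g%:R * h)); last by rewrite lerDr.
by rewrite -ler_pdivrMr.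
Qed.

Theorem theorem1p6 (R : realType) :
  cvgn (@s_partial_sum R) /\
  (limn_esup (fun g : nat =>
     (`|(n_ g)%:R - S_const R * phi R ^+ g| `^ (g%:R^-1))%:E)
   <= (r154 R)%:E)%E.
Proof.
have [cvg_s [C C0 nC]] := error_le R; split=> //.
apply: (@limn_esup_powR_le R _ C (rate R)) => //.
- by rewrite /rate; lra.
- exact: r154_gt.
- by move=> g g2; rewrite normr_ge0 nC.
Qed.
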